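(* Let $\mathcal{D}=(G,\chi,z,\lambda,q)$, $n$, $p=\chi(z)$ and $H_{\mathcal{D}}$ be as in the context, with $(p,q)\neq(1,-1)$. Let $V$ be a $k$-vector space endowed with an $\mathrm{Aut}_{\chi,z}(G)$-gradation $$V=\bigoplus_{\zeta\in\mathrm{Aut}_{\chi,z}(G)}V_{\zeta}$$ and a linear automorphism $\alpha\colon V\to V$ fulfilling - $\alpha(V_{\zeta})=V_{\zeta}$ for all $\zeta\in\mathrm{Aut}_{\chi,z}(G)$, - $\alpha^n=\mathrm{id}$ if $\lambda(z^n-1_G)\neq0$. Then the pair $(V,s)$, where $s\colon H_{\mathcal{D}}\otimes V\to V\otimes H_{\mathcal{D}}$ is the map defined by $$s(gx^i\otimes v):=\alpha^i(v)\otimes\zeta(g)x^i\qquad\text{for all } v\in V_{\zeta}$$ ($g\in G$, $0\le i<n$), is a left $H_{\mathcal{D}}$-space. Furthermore, all the left $H_{\mathcal{D}}$-spaces with underlying $k$-vector space $V$ have this form.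
   Context: $k$ is a field, all maps are $k$-linear, $\otimes=\otimes_k$, and the name of a space also denotes its identity map. Data: $G$ is a finite group, $\chi\colon G\to k^\times$ a character, $z\in G$ central, $q\in k^\times$, $\lambda\in k$, $p:=\chi(z)$; $qp$ is a root of $1$ of order $n>1$; and $\chi^n=1$ if $\lambda(z^n-1_G)\ne0$. $H_{\mathcal D}$ is the braided Hopf algebra generated as an algebra by the group $G$ and an element $x$ with relations $x^n=\lambda(z^n-1_G)$, $xg=\chi(g)gx$ ($g\in G$); it has basis $\{gx^i:g\in G,0\le i<n\}$, comultiplication and counit determined by $\Delta(g)=g\otimes g$, $\Delta(x)=1\otimes x+x\otimes z$, $\epsilon(g)=1$, $\epsilon(x)=0$, and braid $c=c_q$, $c_q(gx^i\otimes hx^j)=q^{ij}hx^j\otimes gx^i$. (As in any braided bialgebra, $\Delta\mu=(\mu\otimes\mu)(H\otimes c\otimes H)(\Delta\otimes\Delta)$.) $\mathrm{Aut}_{\chi,z}(G)$ is the group of automorphisms $\phi$ of $G$ with $\phi(z)=z$ and $\chi\circ\phi=\chi$. For a braided bialgebra $H$ with braid $c$, a left $H$-space is a pair $(V,s)$ with $V$ a vector space and $s\colon H\otimes V\to V\otimes H$ a bijective map such that: $s(1_H\otimes v)=v\otimes1_H$; $s\circ(\mu\otimes V)=(V\otimes\mu)\circ(s\otimes H)\circ(H\otimes s)$; $(V\otimes\epsilon)\circ s=\epsilon\otimes V$; $(V\otimes\Delta)\circ s=(s\otimes H)\circ(H\otimes s)\circ(\Delta\otimes V)$; and $(s\otimes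 H)\circ(H\otimes s)\circ(c\otimes V)=(V\otimes c)\circ(s\otimes H)\circ(H\otimes s)$. *)

(* Defs.v *)
From HB Require Import structures.
From mathcomp Require Import all_boot all_algebra all_fingroup.
From mathcomp Require Import sesquilinear ring_quotient.
From mathcomp Require Import boolp classical_sets.
From mathcomp Require Import freeg.

Set Implicit Arguments.
Unset Strict Implicit.
Unset Printing Implicit Defensive.

Import GRing.Theory Quotient.

Local Open Scope ring_scope.
Local Open Scope quotient_scope.

Record tensor_product (k : fieldType) (U V : lmodType k) := TensorProduct {
  tp_space : lmodType k;
  tp_tens : {bilinear U -> V -> tp_space};
  tp_lift : forall W : lmodType k,
    {bilinear U -> V -> W} -> {linear tp_space -> W};
  tp_liftE : forall (W : lmodType k) (f : {bilinear U -> V -> W}) u v,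
    tp_lift f (tp_tens u v) = f u v;
  tp_ext : forall (W : lmodType k) (g h : {linear tp_space -> W}),
    (forall u v, g (tp_tens u v) = h (tp_tens u v)) -> g =1 h
}.

Module TensorConstruction.

Section Tensor.
Variables (k : fieldType) (U V : lmodType k).

Local Notation free := {freeg (U * V) / k}.

Inductive tnull : free -> Prop :=
| tnull0 : tnull 0
| tnullB x y : tnull x -> tnull y -> tnull (x - y)
| tnullZ a x : tnull x -> tnull (a *: x)
| tnullL a u u' v :
    tnull (<< (a *: u + u', v) >> - a *: << (u, v) >> - << (u', v) >>)
| tnullR a u v v' :
    tnull (<< (u, a *: v + v') >> - a *: << (u, v) >> - << (u, v') >>).

Definition tnullb : {pred free} := fun x => `[< tnull x >].

Fact tnull_zmod_closed : zmod_closed tnullb.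
Proof.
split=> [|x y /asboolP nx /asboolP ny]; first exact/asboolP/tnull0.
exact/asboolP/tnullB.
Qed.

HB.instance Definition _ := GRing.isZmodClosed.Build free tnullb
  tnull_zmod_closed.

Definition tensor : Type := {quot tnullb}.

HB.instance Definition _ := GRing.Zmodule.on tensor.

Let pit : free -> tensor := \pi_{quot tnullb}.
Let rept : tensor -> free := generic_quotient.repr.

Let pitB : {morph pit : x y / x - y}.
Proof. by move=> x y; rewrite /pit raddfB. Qed.

Let pitD : {morph pit : x y / x + y}.
Proof. by move=> x y; rewrite /pit raddfD. Qed.

Let reptK : cancel rept pit. Proof. exact: reprK. Qed.

Let pit_eq x y : pit x = pit y <-> tnull (x - y).
Proof.
by split=> [/eqP|] h; [apply/asboolP|apply/eqP];
  rewrite -(idealrBE tnullb) in h *; last exact/asboolP.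
Qed.

Definition tensor_scale (a : k) (t : tensor) : tensor :=
  pit (a *: rept t).

Let scale_pit a x : tensor_scale a (pit x) = pit (a *: x).
Proof.
by apply/pit_eq; rewrite -scalerBr; apply/tnullZ/pit_eq; rewrite reptK.
Qed.

Fact tensor_scaleA a b t :
  tensor_scale a (tensor_scale b t) = tensor_scale (a * b) t.
Proof. by rewrite -[t]reptK !scale_pit scalerA. Qed.

Fact tensor_scale1 : left_id 1 tensor_scale.
Proof. by move=> t; rewrite -[t]reptK !scale_pit scale1r. Qed.

Fact tensor_scaleDr : right_distributive tensor_scale +%R.
Proof.
move=> a s t; rewrite -[s]reptK -[t]reptK -pitD !scale_pit scalerDr.
by rewrite pitD.
Qed.

Fact tensor_scaleDl t : {morph tensor_scale^~ t : a b / a + b}.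
Proof. by move=> a b; rewrite -[t]reptK !scale_pit scalerDl pitD. Qed.

HB.instance Definition _ := GRing.Zmodule_isLmodule.Build k tensor
  tensor_scaleA tensor_scale1 tensor_scaleDr tensor_scaleDl.

Definition space : lmodType k := tensor.

Let pitZ a x : pit (a *: x) = a *: pit x.
Proof. exact/esym/scale_pit. Qed.

Definition tens (u : U) (v : V) : space := pit << (u, v) >>.

Fact tens_bilinear : bilinear_for
  (GRing.Scale.Law.clone _ _ *:%R _) (GRing.Scale.Law.clone _ _ *:%R _) tens.
Proof.
split=> [v a u u'|u a v v'] /=; rewrite /tens -pitZ -pitD; apply/pit_eq;
  rewrite opprD addrA; [exact: tnullL|exact: tnullR].
Qed.

HB.instance Definition _ := bilinear_isBilinear.Build k U V space
  *:%R *:%R tens tens_bilinear.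

Definition tens_bilinear_map : {bilinear U -> V -> space} := tens.

Section Lift.
Variable W : lmodType k.

Let lift0 (f : U * V -> W) : free -> W := fglift f.

Let lift0B f : {morph lift0 f : x y / x - y}.
Proof. exact: lift_is_additive. Qed.

Let lift00 f : lift0 f 0 = 0.
Proof. by rewrite -[X in lift0 f X](subrr 0) lift0B subrr. Qed.

Let lift0D f : {morph lift0 f : x y / x + y}.
Proof.
move=> x y; rewrite -[y in LHS]opprK lift0B -(sub0r y).
by rewrite lift0B lift00 sub0r opprK.
Qed.

Let lift0Z f a x : lift0 f (a *: x) = a *: lift0 f x.
Proof.
elim/freeg_ind_dom0: x => [|b x y _ _ IHy]; first by rewrite scaler0 lift00 scaler0.
have -> : a *: (<< b *g x >> + y) = << (a * b) *g x >> + a *: y.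
  rewrite scalerDr; congr (_ + _); apply/eqP/freeg_eqP => z.
  by rewrite coeffZ !coeffU mulrA.
by rewrite !lift0D IHy /lift0 !liftU scalerDr scalerA.
Qed.

Definition tlift (f : U -> V -> W) (t : space) : W :=
  lift0 (fun uv => f uv.1 uv.2) (rept t).

Variable f : {bilinear U -> V -> W}.

Let lift0_null x : tnull x -> lift0 (fun uv => f uv.1 uv.2) x = 0.
Proof.
elim=> {x} [|x y _ IHx _ IHy|a x _ IHx|a u u' v|a u v v'].
- exact: lift00.
- by rewrite lift0B IHx IHy subr0.
- by rewrite lift0Z IHx scaler0.
- rewrite !lift0B lift0Z /lift0 !liftU /= !scale1r.
  by rewrite linearPl (addrC (a *: _)) addrK subrr.
- rewrite !lift0B lift0Z /lift0 !liftU /= !scale1r.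
  by rewrite linearPr (addrC (a *: _)) addrK subrr.
Qed.

Let tlift_pit x : tlift f (pit x) = lift0 (fun uv => f uv.1 uv.2) x.
Proof.
apply/eqP; rewrite -subr_eq0 -lift0B; apply/eqP/lift0_null/pit_eq.
exact: reptK.
Qed.

Fact tlift_linear : linear (tlift f).
Proof.
move=> a s t; rewrite -[s]reptK -[t]reptK -pitZ -pitD !tlift_pit.
by rewrite lift0D lift0Z.
Qed.

HB.instance Definition _ := GRing.isLinear.Build k space W *:%R (tlift f)
  tlift_linear.

Definition tlift_linear_map : {linear space -> W} := tlift f.

Lemma tliftE u v : tlift f (tens u v) = f u v.
Proof. by rewrite tlift_pit /lift0 liftU scale1r. Qed.

Lemma tensor_ext (g h : {linear space -> W}) :
  (forall u v, g (tens u v) = h (tens u v)) -> g =1 h.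
Proof.
move=> gh t; rewrite -[t]reptK; elim/freeg_ind_dom0: (rept t) => [|b x y _ _ IHy].
  by rewrite /pit raddf0 !linear0.
have -> : << b *g x >> = b *: << x >> :> free.
  by apply/eqP/freeg_eqP => z; rewrite coeffZ !coeffU mul1r.
rewrite pitD pitZ !linearD !linearZ IHy; congr (_ *: _ + _).
by case: x => u v; apply: gh.
Qed.

End Lift.
End Tensor.

End TensorConstruction.

(* Opaque on purpose: only the universal property is available afterwards, and
   unification never unfolds the quotient. *)
Definition tensor_construction (k : fieldType) (U V : lmodType k) :
  tensor_product U V.
Proof.
exists (TensorConstruction.space U V) (TensorConstruction.tens_bilinear_map U V)
  (@TensorConstruction.tlift_linear_map k U V).
- exact: TensorConstruction.tliftE.
- exact: TensorConstruction.tensor_ext.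
Qed.

Definition tensor (k : fieldType) (U V : lmodType k) : lmodType k :=
  tp_space (tensor_construction U V).

Notation "U ⊗ V" := (tensor U V) (at level 40, left associativity).

Definition tens (k : fieldType) (U V : lmodType k) :
  {bilinear U -> V -> (U ⊗ V)} := tp_tens (tensor_construction U V).

Arguments tens {k U V}.

Notation "u *t v" := (tens u v) (at level 40, left associativity) : ring_scope.

Section TensorUniversal.
Variables (k : fieldType) (U V W : lmodType k).

Definition tlift (f : {bilinear U -> V -> W}) : {linear U ⊗ V -> W} :=
  tp_lift (tensor_construction U V) f.

Lemma tliftE (f : {bilinear U -> V -> W}) u v : tlift f (u *t v) = f u v.
Proof. exact: tp_liftE. Qed.

Lemma tensor_ext (g h : {linear U ⊗ V -> W}) :
  (forall u v, g (u *t v) = h (u *t v)) -> g =1 h.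
Proof. exact: tp_ext. Qed.

End TensorUniversal.

Section TensorMap.
Variables (k : fieldType) (U U' V V' : lmodType k).
Variables (f : {linear U -> U'}) (g : {linear V -> V'}).

Definition tmap_on (u : U) (v : V) : U' ⊗ V' := f u *t g v.

Fact tmap_on_bilinear : bilinear_for
  (GRing.Scale.Law.clone _ _ *:%R _) (GRing.Scale.Law.clone _ _ *:%R _) tmap_on.
Proof.
split=> [v a u u'|u a v v'] /=; rewrite /tmap_on linearP.
  by rewrite linearPl.
by rewrite linearPr.
Qed.

HB.instance Definition _ := bilinear_isBilinear.Build k U V (U' ⊗ V')
  *:%R *:%R tmap_on tmap_on_bilinear.

Definition tmap : U ⊗ V -> U' ⊗ V' := tlift tmap_on.

HB.instance Definition _ := GRing.Linear.on tmap.

Lemma tmapE u v : tmap (u *t v) = f u *t g v.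
Proof. exact: tliftE. Qed.

End TensorMap.

Arguments tmap {k U U' V V'} f g t.

Section Associator.
Variables (k : fieldType) (A B C : lmodType k).

Definition tassoc_on2 (c : C) (a : A) (b : B) : A ⊗ (B ⊗ C) := a *t (b *t c).

Fact tassoc_on2_bilinear c : bilinear_for
  (GRing.Scale.Law.clone _ _ *:%R _) (GRing.Scale.Law.clone _ _ *:%R _)
  (tassoc_on2 c).
Proof.
split=> [v a u u'|u a v v'] /=; rewrite /tassoc_on2 linearPl //.
by rewrite linearPr.
Qed.

HB.instance Definition _ c := bilinear_isBilinear.Build k A B (A ⊗ (B ⊗ C))
  *:%R *:%R (tassoc_on2 c) (tassoc_on2_bilinear c).

Definition tassoc_on (t : A ⊗ B) (c : C) : A ⊗ (B ⊗ C) := tlift (tassoc_on2 c) t.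

Fact tassoc_on_bilinear : bilinear_for
  (GRing.Scale.Law.clone _ _ *:%R _) (GRing.Scale.Law.clone _ _ *:%R _)
  tassoc_on.
Proof.
split=> [c a t t'|t a c c'] /=; rewrite /tassoc_on; first by rewrite linearP.
pose h d := tlift (tassoc_on2 d).
suff: h (a *: c + c') =1 a \*: h c \+ h c' by move/(_ t).
apply: tensor_ext => u v /=; rewrite !tliftE /= /tassoc_on2.
by rewrite !linearPr.
Qed.

HB.instance Definition _ := bilinear_isBilinear.Build k (A ⊗ B) C
  (A ⊗ (B ⊗ C)) *:%R *:%R tassoc_on tassoc_on_bilinear.

Definition tassoc : A ⊗ B ⊗ C -> A ⊗ (B ⊗ C) := tlift tassoc_on.

HB.instance Definition _ := GRing.Linear.on tassoc.

Lemma tassocE a b c : tassoc (a *t b *t c) = a *t (b *t c).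
Proof. by rewrite /tassoc tliftE /= /tassoc_on tliftE. Qed.

Definition tassocV_on2 (a : A) (b : B) (c : C) : A ⊗ B ⊗ C := a *t b *t c.

Fact tassocV_on2_bilinear a : bilinear_for
  (GRing.Scale.Law.clone _ _ *:%R _) (GRing.Scale.Law.clone _ _ *:%R _)
  (tassocV_on2 a).
Proof.
split=> [v b u u'|u b v v'] /=; rewrite /tassocV_on2 linearPr //.
by rewrite linearPl.
Qed.

HB.instance Definition _ a := bilinear_isBilinear.Build k B C (A ⊗ B ⊗ C)
  *:%R *:%R (tassocV_on2 a) (tassocV_on2_bilinear a).

Definition tassocV_on (a : A) (t : B ⊗ C) : A ⊗ B ⊗ C := tlift (tassocV_on2 a) t.

Fact tassocV_on_bilinear : bilinear_for
  (GRing.Scale.Law.clone _ _ *:%R _) (GRing.Scale.Law.clone _ _ *:%R _)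
  tassocV_on.
Proof.
split=> [t b a a'|a b t t'] /=; rewrite /tassocV_on; last by rewrite linearP.
pose h d := tlift (tassocV_on2 d).
suff: h (b *: a + a') =1 b \*: h a \+ h a' by move/(_ t).
apply: tensor_ext => u v /=; rewrite !tliftE /= /tassocV_on2.
by rewrite !linearPl.
Qed.

HB.instance Definition _ := bilinear_isBilinear.Build k A (B ⊗ C)
  (A ⊗ B ⊗ C) *:%R *:%R tassocV_on tassocV_on_bilinear.

Definition tassocV : A ⊗ (B ⊗ C) -> A ⊗ B ⊗ C := tlift tassocV_on.

HB.instance Definition _ := GRing.Linear.on tassocV.

Lemma tassocVE a b c : tassocV (a *t (b *t c)) = a *t b *t c.
Proof. by rewrite /tassocV tliftE /= /tassocV_on tliftE. Qed.

End Associator.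

Arguments tassoc {k A B C} t.
Arguments tassocV {k A B C} t.

Section MoreMaps.
Variable k : fieldType.

Definition tscalel_on (V : lmodType k) (a : k^o) (v : V) : V := a *: v.

Fact tscalel_on_bilinear V : bilinear_for
  (GRing.Scale.Law.clone _ _ *:%R _) (GRing.Scale.Law.clone _ _ *:%R _)
  (@tscalel_on V).
Proof.
split=> [v a b c|b a v v'] /=; rewrite /tscalel_on.
  by rewrite scalerDl -scalerA.
by rewrite scalerDr !scalerA mulrC.
Qed.

HB.instance Definition _ V := bilinear_isBilinear.Build k k^o V V *:%R *:%R
  (@tscalel_on V) (tscalel_on_bilinear V).

Definition tscalel (V : lmodType k) : k^o ⊗ V -> V := tlift (@tscalel_on V).

HB.instance Definition _ V := GRing.Linear.on (@tscalel V).

Definition tscaler_on (V : lmodType k) (v : V) (a : k^o) : V := a *: v.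

Fact tscaler_on_bilinear V : bilinear_for
  (GRing.Scale.Law.clone _ _ *:%R _) (GRing.Scale.Law.clone _ _ *:%R _)
  (@tscaler_on V).
Proof.
split=> [b a v v'|v a b c] /=; rewrite /tscaler_on.
  by rewrite scalerDr !scalerA mulrC.
by rewrite scalerDl -scalerA.
Qed.

HB.instance Definition _ V := bilinear_isBilinear.Build k V k^o V *:%R *:%R
  (@tscaler_on V) (tscaler_on_bilinear V).

Definition tscaler (V : lmodType k) : V ⊗ k^o -> V := tlift (@tscaler_on V).

HB.instance Definition _ V := GRing.Linear.on (@tscaler V).

Definition tmul_on (H : algType k) (a b : H) : H := a * b.

Fact tmul_on_bilinear H : bilinear_for
  (GRing.Scale.Law.clone _ _ *:%R _) (GRing.Scale.Law.clone _ _ *:%R _)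
  (@tmul_on H).
Proof.
split=> [c a x y|c a x y] /=; rewrite /tmul_on.
  by rewrite mulrDl scalerAl.
by rewrite mulrDr scalerAr.
Qed.

HB.instance Definition _ (H : algType k) :=
  bilinear_isBilinear.Build k H H H *:%R *:%R (@tmul_on H) (tmul_on_bilinear H).

Definition tmul (H : algType k) : H ⊗ H -> H := tlift (@tmul_on H).

HB.instance Definition _ (H : algType k) := GRing.Linear.on (@tmul H).

Lemma tscalelE (V : lmodType k) a (v : V) : tscalel (a *t v) = a *: v.
Proof. exact: tliftE. Qed.

Lemma tscalerE (V : lmodType k) a (v : V) : tscaler (v *t a) = a *: v.
Proof. exact: tliftE. Qed.

Lemma tmulE (H : algType k) (a b : H) : tmul (a *t b) = a * b.
Proof. exact: tliftE. Qed.

Definition tapp12 (A B C A' B' : lmodType k) (f : {linear A ⊗ B -> A' ⊗ B'}) :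
  A ⊗ B ⊗ C -> A' ⊗ B' ⊗ C := tmap f idfun.

Definition tapp23 (A B C B' C' : lmodType k) (f : {linear B ⊗ C -> B' ⊗ C'}) :
  A ⊗ B ⊗ C -> A ⊗ B' ⊗ C' :=
  tassocV \o tmap idfun f \o tassoc.

HB.instance Definition _ A B C A' B' f := GRing.Linear.on (@tapp12 A B C A' B' f).
HB.instance Definition _ A B C B' C' f := GRing.Linear.on (@tapp23 A B C B' C' f).

Definition tmid (A B C D B' C' : lmodType k) (f : {linear B ⊗ C -> C' ⊗ B'}) :
  (A ⊗ B) ⊗ (C ⊗ D) -> (A ⊗ C') ⊗ (B' ⊗ D) :=
  tassoc \o tmap (@tapp23 A B C C' B' f) idfun \o tassocV.

HB.instance Definition _ A B C D B' C' f := GRing.Linear.on (@tmid A B C D B' C' f).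

Lemma tapp12E (A B C A' B' : lmodType k) (f : {linear A ⊗ B -> A' ⊗ B'})
    t (c : C) :
  tapp12 f (t *t c) = f t *t c.
Proof. exact: tmapE. Qed.

Lemma tapp23E (A B C B' C' : lmodType k) (f : {linear B ⊗ C -> B' ⊗ C'})
    (a : A) b c :
  tapp23 f (a *t b *t c) = tassocV (a *t f (b *t c)).
Proof. by rewrite /tapp23 /= tassocE tmapE. Qed.

Lemma tmidE (A B C D B' C' : lmodType k) (f : {linear B ⊗ C -> C' ⊗ B'})
    (a : A) b c (d : D) :
  tmid f ((a *t b) *t (c *t d)) = tassoc (tapp23 f (a *t b *t c) *t d).
Proof. by rewrite /tmid /= tassocVE tmapE. Qed.

End MoreMaps.

Arguments tscalel {k V} t.
Arguments tscaler {k V} t.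
Arguments tmul {k H} t.
Arguments tapp12 {k A B C A' B'} f t.
Arguments tapp23 {k A B C B' C'} f t.
Arguments tmid {k A B C D B' C'} f t.

Record braidedBialgebra (k : fieldType) := BraidedBialgebra {
  bialg_alg :> algType k;
  comul : {linear bialg_alg -> bialg_alg ⊗ bialg_alg};
  counit : {linear bialg_alg -> k^o};
  braid : {linear bialg_alg ⊗ bialg_alg -> bialg_alg ⊗ bialg_alg};
  comulA : tassoc \o tmap comul idfun \o comul =1 tmap idfun comul \o comul;
  comul_counitl : tscalel \o tmap counit idfun \o comul =1 idfun;
  comul_counitr : tscaler \o tmap idfun counit \o comul =1 idfun;
  braid_bij : bijective braid;
  braid_eq : tapp12 braid \o tapp23 braid \o tapp12 braid
             =1 (tapp23 braid \o tapp12 braid \o tapp23 braid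
                 : bialg_alg ⊗ bialg_alg ⊗ bialg_alg ->
                   bialg_alg ⊗ bialg_alg ⊗ bialg_alg);
  braid1l : forall h, braid (1 *t h) = h *t 1;
  braid1r : forall h, braid (h *t 1) = 1 *t h;
  braid_mull : braid \o tmap tmul idfun
               =1 tmap idfun tmul \o tassoc \o tapp12 braid \o tapp23 braid;
  braid_mulr : braid \o tmap idfun tmul \o tassoc
               =1 tmap tmul idfun \o tapp23 braid \o tapp12 braid;
  braid_counitl : tscaler \o tmap idfun counit \o braid
                  =1 tscalel \o tmap counit idfun;
  braid_counitr : tscalel \o tmap counit idfun \o braid
                  =1 tscaler \o tmap idfun counit;
  braid_comull : tassocV \o tmap idfun comul \o braid
                 =1 tapp12 braid \o tapp23 braid \o tmap comul idfun;
  braid_comulr : tmap comul idfun \o braid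
                 =1 tapp23 braid \o tapp12 braid \o tassocV \o tmap idfun comul;
  comul1 : comul 1 = 1 *t 1;
  comulM : comul \o tmul =1 tmap tmul tmul \o tmid braid \o tmap comul comul;
  counit1 : counit 1 = 1;
  counitM : forall g h, counit (g * h) = counit g * counit h
}.

Arguments comul {k b}.
Arguments counit {k b}.
Arguments braid {k b}.

Record braidedHopf (k : fieldType) := BraidedHopf {
  hopf_bialg :> braidedBialgebra k;
  antipode : {linear hopf_bialg -> hopf_bialg};
  antipodel : forall h : hopf_bialg,
    tmul (tmap antipode idfun (comul h)) = counit h *: 1;
  antipoder : forall h : hopf_bialg,
    tmul (tmap idfun antipode (comul h)) = counit h *: 1
}.

Arguments antipode {k b}.

Record left_space (k : fieldType) (H : braidedBialgebra k) (V : lmodType k)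
    (s : {linear H ⊗ V -> V ⊗ H}) : Prop := LeftSpace {
  left_space_bij : bijective s;
  left_space1 : forall v, s (1 *t v) = v *t 1;
  left_spaceM : s \o tmap tmul idfun
                =1 tmap idfun tmul \o tassoc \o tapp12 s \o tapp23 s;
  left_space_counit : tscaler \o tmap idfun counit \o s
                      =1 tscalel \o tmap counit idfun;
  left_space_comul : tassocV \o tmap idfun comul \o s
                     =1 tapp12 s \o tapp23 s \o tmap comul idfun;
  left_space_braid : tapp12 s \o tapp23 s \o tapp12 braid
                     =1 tapp23 braid \o tapp12 s \o tapp23 s
}.

Definition mult_char (k : fieldType) (gT : finGroupType) (chi : gT -> k) :=
  (forall g, chi g != 0) /\ {morph chi : g h / (g * h)%g >-> g * h}.

(* Given the relations, injectivity and surjectivity of the coordinate map in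
   [HD_basis] say that [H] is presented by them on the generators
   [iota g], [x]. *)
Record is_HD (k : fieldType) (gT : finGroupType) (chi : gT -> k) (z : gT)
    (lambda q : k) (n : nat) (H : braidedHopf k) (iota : gT -> H) (x : H) :
    Prop := IsHD {
  HD_iota1 : iota 1%g = 1;
  HD_iotaM : {morph iota : g h / (g * h)%g >-> g * h};
  HD_xn : x ^+ n = lambda *: (iota (z ^+ n)%g - 1);
  HD_xg : forall g, x * iota g = chi g *: (iota g * x);
  HD_basis : bijective (fun a : {ffun gT * 'I_n -> k} =>
               \sum_b a b *: (iota b.1 * x ^+ b.2));
  HD_comul_iota : forall g, comul (iota g) = iota g *t iota g;
  HD_comul_x : comul x = 1 *t x + x *t iota z;
  HD_counit_iota : forall g, counit (iota g) = 1;
  HD_counit_x : counit x = 0;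
  HD_braid : forall g h (i j : 'I_n),
    braid ((iota g * x ^+ i) *t (iota h * x ^+ j)) =
    q ^+ (i * j)%N *: ((iota h * x ^+ j) *t (iota g * x ^+ i))
}.

Section AutChi.
Variables (k : fieldType) (gT : finGroupType) (chi : gT -> k) (z : gT).

Definition Aut_chi_z : {set {perm gT}} :=
  [set phi in Aut [set: gT] | (phi z == z) && [forall g, chi (phi g) == chi g]].

Lemma Aut_chi_zE phi : (phi \in Aut_chi_z) =
  [&& phi \in Aut [set: gT], phi z == z & [forall g, chi (phi g) == chi g]].
Proof. by rewrite finset.in_set. Qed.

Fact Aut_chi_z_group_set : group_set Aut_chi_z.
Proof.
apply/group_setP; split.
  rewrite Aut_chi_zE group1 perm1 eqxx; apply/forallP => g.
  by rewrite perm1.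
move=> f h; rewrite !Aut_chi_zE => /and3P[Af /eqP fz /forallP cf].
move=> /and3P[Ah /eqP hz /forallP ch]; apply/and3P; split.
- exact: groupM.
- by rewrite permM fz hz.
- by apply/forallP => g; rewrite permM (eqP (ch _)).
Qed.

Canonical Aut_chi_z_group := Group Aut_chi_z_group_set.

End AutChi.

Definition gradation (k : fieldType) (V : lmodType k) (I : finType)
    (W : I -> {pred V}) :=
  (forall i, GRing.submod_closed (W i)) /\
  (forall v, exists! w : {ffun I -> V},
     (forall i, w i \in W i) /\ v = \sum_i w i).

Section Transposition.
Variables (k : fieldType) (gT : finGroupType) (chi : gT -> k) (z : gT).
Variables (lambda : k) (n : nat) (H : braidedHopf k).
Variables (iota : gT -> H) (x : H) (V : lmodType k).
Variables (W : subg_of (Aut_chi_z_group chi z) -> {pred V}).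
Variables (alpha : {linear V -> V}).

Definition graded_auto :=
  [/\ gradation W,
      bijective alpha,
      forall zeta, (alpha @` [set` W zeta] = [set` W zeta])%classic
    & lambda *: (iota (z ^+ n)%g - 1) != 0 -> iter n alpha =1 id].

Definition has_form (s : {linear H ⊗ V -> V ⊗ H}) :=
  forall zeta v g (i : 'I_n), v \in W zeta ->
    s ((iota g * x ^+ i) *t v) =
    iter i alpha v *t (iota (sgval zeta g) * x ^+ i).

End Transposition.

(* Main.v *)
(* For the converse, write s(a ⊗ v) = sum_b T(a, b)(v) ⊗ b over the basis
   b = h x^j.  Since
     Delta(h x^m) = sum_j [m choose j]_(qp) h x^j ⊗ h z^j x^(m-j),
   compatibility with Delta makes the T(g, h) orthogonal idempotents with sum
   the identity, and expresses T(g, h x^l) through T(g, h x), because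
   [l]_(qp) is nonzero for 0 < l < n.  Compatibility with the braid says that
   T(b1, c1) and T(b2, c2) commute up to a power of q.
   If z <> 1, commuting T(g, h) with T(g, h x) kills the latter.  Delta(x) then
   yields s(x ⊗ v) = P v ⊗ 1 - sum_(h <> 1) P (T(z, h) v) ⊗ h + Q v ⊗ x.  If
   p <> 1 the relation xz = pzx gives P = 0; if p = 1 then q <> 1, -1, so q-
   commutation gives PP = PQ = QP = 0, hence s(x ⊗ P v) = 0 and P = 0 as s is
   injective.  Thus s(x ⊗ v) = Q v ⊗ x with Q injective; if z = 1, the relation
   xg = chi(g) gx against q-commutation now kills T(g, h x).  So
   s(g ⊗ v) = sum_h T(g, h) v ⊗ h, the V_zeta are the joint eigenspaces of the
   commuting idempotents T(g, h), and alpha = Q. *)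
From HB Require Import structures.
Require Import Defs.
From mathcomp Require Import all_boot all_algebra all_fingroup center.
From mathcomp Require Import sesquilinear boolp.

Set Implicit Arguments.
Unset Strict Implicit.
Unset Printing Implicit Defensive.

Import GRing.Theory.
Local Open Scope ring_scope.

(** * Coordinates on tensor products with a based space *)

Section LinearPacking.
Variables (k : fieldType) (U V : lmodType k).

Lemma linear_ex (f : U -> V) : linear f -> exists g : {linear U -> V}, g =1 f.
Proof.
move=> lf; pose m := GRing.isLinear.Build k U V *:%R f lf.
pose g : {linear U -> V} := HB.pack f m.
by exists g.
Qed.

End LinearPacking.

Section TensorCoordinates.
Variables (k : fieldType) (H : lmodType k) (I : finType) (e : I -> H).
Variable co : I -> {linear H -> k^o}.
Hypothesis coE : forall i j, co i (e j) = (i == j)%:R.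
Hypothesis co_sum : forall h, h = \sum_i (co i h : k) *: e i.

Lemma sum_delta (W : lmodType k) (i : I) (w : I -> W) :
  \sum_j (i == j)%:R *: w j = w i.
Proof.
rewrite (bigD1 i) //= eqxx scale1r big1 ?addr0 // => j.
by rewrite eq_sym => /negPf ->; rewrite scale0r.
Qed.

(* [locked] keeps [/=] from unfolding the coordinate maps inside sums. *)
Definition cor (V : lmodType k) (i : I) : {linear V ⊗ H -> V} :=
  locked (tscaler \o tmap idfun (co i) : {linear V ⊗ H -> V}).

Arguments cor {V} i.

(** The index [i] belongs to the middle factor and [j] to the last. *)
Definition corr (V : lmodType k) (i j : I) : {linear V ⊗ H ⊗ H -> V} :=
  locked (@cor V i \o @cor (V ⊗ H) j : {linear V ⊗ H ⊗ H -> V}).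

Arguments corr {V} i j.

Lemma corE (V : lmodType k) i (v : V) h : cor i (v *t h) = (co i h : k) *: v.
Proof. by rewrite /cor -lock /= tmapE tscalerE. Qed.

Lemma corrE (V : lmodType k) i j (t : V ⊗ H) h :
  corr i j (t *t h) = (co j h : k) *: cor i t.
Proof. by rewrite /corr -lock /= corE linearZ. Qed.

Variable V : lmodType k.

Definition col (i : I) : {linear H ⊗ V -> V} :=
  locked (tscalel \o tmap (co i) idfun : {linear H ⊗ V -> V}).

Lemma colE i v h : col i (h *t v) = (co i h : k) *: v.
Proof. by rewrite /col -lock /= tmapE tscalelE. Qed.

Lemma cor_sum (t : V ⊗ H) : t = \sum_i cor i t *t e i.
Proof.
have /linear_ex[g gE] : linear (fun t : V ⊗ H => \sum_i cor i t *t e i).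
  move=> a t1 t2; rewrite scaler_sumr -big_split; apply: eq_bigr => i _ /=.
  by rewrite linearP linearPl.
rewrite -gE; move: t; apply: (@tensor_ext _ _ _ _ idfun) => v h /=.
rewrite gE /= [in LHS](co_sum h) linear_sumr; apply: eq_bigr => i _.
by rewrite corE linearZr_LR /= linearZl_LR.
Qed.

Lemma col_sum (t : H ⊗ V) : t = \sum_i e i *t col i t.
Proof.
have /linear_ex[g gE] : linear (fun t : H ⊗ V => \sum_i e i *t col i t).
  move=> a t1 t2; rewrite scaler_sumr -big_split; apply: eq_bigr => i _ /=.
  by rewrite linearP linearPr.
rewrite -gE; move: t; apply: (@tensor_ext _ _ _ _ idfun) => h v /=.
rewrite gE /= [in LHS](co_sum h) linear_sumlz; apply: eq_bigr => i _.
by rewrite colE linearZr_LR /= linearZl_LR.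
Qed.

Lemma cor_inj (t t' : V ⊗ H) : (forall i, cor i t = cor i t') -> t = t'.
Proof.
move=> tt'; rewrite (cor_sum t) (cor_sum t').
by apply: eq_bigr => i _; rewrite tt'.
Qed.

Lemma tensr_inj (h : H) (v v' : V) : h != 0 -> v *t h = v' *t h -> v = v'.
Proof.
move=> h0 vh; have [i hi] : exists i, co i h != 0.
  apply/existsP; apply: contraNT h0 => /existsPn hi.
  rewrite (co_sum h) big1 // => i _.
  by move: (hi i) => /negPn/eqP ->; rewrite scale0r.
by move/(congr1 (cor (V := V) i)): vh; rewrite !corE => /(scalerI hi).
Qed.

Lemma tens_basis_eq0 i (v : V) : e i *t v = 0 -> v = 0.
Proof. by move/(congr1 (col i)); rewrite colE coE eqxx scale1r linear0. Qed.

Lemma tensor_basis_ext (X : lmodType k) (f g : {linear H ⊗ V -> X}) :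
  (forall i (v : V), f (e i *t v) = g (e i *t v)) -> f =1 g.
Proof.
move=> fg; apply: tensor_ext => h v.
rewrite (co_sum h) linear_sumlz !linear_sum.
by apply: eq_bigr => i _; rewrite linearZl_LR !linearZ fg.
Qed.

Lemma tensor_basis_ext_l (X : lmodType k) (f g : {linear V ⊗ H -> X}) :
  (forall i (v : V), f (v *t e i) = g (v *t e i)) -> f =1 g.
Proof.
move=> fg; apply: tensor_ext => v h; rewrite (co_sum h) linear_sumr !linear_sum.
by apply: eq_bigr => i _; rewrite linearZr_LR !linearZ fg.
Qed.

End TensorCoordinates.

Arguments cor {k H I} co {V} i.
Arguments corr {k H I} co {V} i j.
Arguments col {k H I} co {V} i.

Section TensorCoordinates3.
Variables (k : fieldType) (H : lmodType k) (I : finType) (e : I -> H).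
Variable co : I -> {linear H -> k^o}.
Hypothesis co_sum : forall h, h = \sum_i (co i h : k) *: e i.
Variables (V X : lmodType k).

Lemma tensor3_basis_ext (f g : {linear H ⊗ H ⊗ V -> X}) :
  (forall i j v, f (e i *t e j *t v) = g (e i *t e j *t v)) -> f =1 g.
Proof.
move=> fg; apply: tensor_ext => t v; rewrite (cor_sum co_sum t).
rewrite linear_sumlz !linear_sum; apply: eq_bigr => j _.
rewrite (co_sum (cor co j t)) linear_sumlz linear_sumlz !linear_sum.
apply: eq_bigr => i _.
by rewrite linearZl_LR /= linearZl_LR /= !linearZ /= fg.
Qed.

Lemma tensor3_basis_ext_l (f g : {linear V ⊗ H ⊗ H -> X}) :
  (forall v i j, f (v *t e i *t e j) = g (v *t e i *t e j)) -> f =1 g.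
Proof.
move=> fg; apply: (tensor_basis_ext_l co_sum) => j t.
rewrite (cor_sum co_sum t).
by rewrite linear_sumlz !linear_sum; apply: eq_bigr => i _.
Qed.

End TensorCoordinates3.

(** * Joint eigenspaces of commuting idempotents; gradations *)

Section JointEigenspaces.
Variables (k : fieldType) (V : lmodType k) (I : finType).
Variable E : I -> I -> V -> V.
Hypothesis E_lin : forall i j, linear (E i j).
Hypothesis E_idem : forall i j j' v, E i j (E i j' v) = (j' == j)%:R *: E i j v.
Hypothesis E_sum : forall i v, \sum_j E i j v = v.
Hypothesis E_comm : forall i i' j j' v, E i j (E i' j' v) = E i' j' (E i j v).

Definition joint_eigen (f : I -> I) (v : V) := forall i, E i (f i) v = v.

Let E0 i j : E i j 0 = 0.
Proof. by have := E_lin i j (-1) 0 0; rewrite scaler0 addr0 scaleN1r addNr. Qed.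

Let E_sumr i j J (r : seq J) (P : pred J) F :
  E i j (\sum_(a <- r | P a) F a) = \sum_(a <- r | P a) E i j (F a).
Proof.
elim/big_rec2: _ => [|a u w _ <-]; first exact: E0.
by have := E_lin i j 1 (F a) w; rewrite !scale1r.
Qed.

Lemma joint_eigenE f v i j : joint_eigen f v -> E i j v = (f i == j)%:R *: v.
Proof.
move=> fv; rewrite -{1}(fv i) E_idem.
have [<-|_] := eqVneq; first by rewrite fv.
by rewrite !scale0r.
Qed.

(** Treat the indices [i] one at a time, splitting each component by the idempotents [E i j], which
    sum to the identity; commutation preserves the eigenvector conditions already obtained. *)
Lemma joint_decomposition v : exists w : {ffun I -> I} -> V,
  v = \sum_f w f /\
  forall f : {ffun I -> I}, joint_eigen f (w f).
Proof.
suff [w [vw wE]] : exists w : {ffun I -> I} -> V, v = \sum_f w f /\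
    forall (f : {ffun I -> I}) i, i \in enum I -> E i (f i) (w f) = w f.
  by exists w; split=> // f i; apply: wE; rewrite mem_enum.
elim: (enum I) (enum_uniq I) => [_|i l IHl /= /andP[il /IHl[w [vw wE]]]].
  exists (fun f : {ffun I -> I} => (f == [ffun i => i])%:R *: v); split=> //.
  rewrite (bigD1 [ffun i => i]) //= eqxx scale1r big1 ?addr0 // => f /negPf ->.
  by rewrite scale0r.
pose upd (f : {ffun I -> I}) j : {ffun I -> I} :=
  [ffun i' => if i' == i then j else f i'].
(* The new component at [f] collects the [E i (f i)]-parts of the old components at those [f'] that
   agree with [f] away from [i]. *)
exists (fun f : {ffun I -> I} =>
  \sum_(f' | f == upd f' (f i)) E i (f i) (w f')); split.
  rewrite (exchange_big_dep xpredT) //= vw; apply: eq_bigr => f' _.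
  rewrite (reindex_onto (upd f') (fun f : {ffun I -> I} => f i));
    last by move=> f /eqP <-.
  rewrite -[LHS](E_sum i); apply: eq_big => [j|j _]; rewrite ffunE eqxx //.
  by rewrite !eqxx.
move=> f i'; rewrite inE E_sumr => i'l; apply: eq_bigr => f' /eqP ff'.
have [->|ii'] := eqVneq i' i; first by rewrite E_idem eqxx scale1r.
rewrite (negPf ii') /= in i'l.
have fi' : f i' = f' i' by rewrite ff' ffunE (negPf ii').
by rewrite E_comm fi' wE.
Qed.

(** On sums of joint eigenvectors this composite extracts the component at [f], which yields
    uniqueness of the decomposition. *)
Definition joint_proj (f : I -> I) (v : V) :=
  foldr (fun i u => E i (f i) u) v (enum I).

Lemma joint_proj_sum f J (r : seq J) (P : pred J) F :
  joint_proj f (\sum_(a <- r | P a) F a) =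
  \sum_(a <- r | P a) joint_proj f (F a).
Proof.
by rewrite /joint_proj; elim: (enum I) => //= i l ->; rewrite E_sumr.
Qed.

Lemma joint_proj_eigen (f f' : {ffun I -> I}) v : joint_eigen f' v ->
  joint_proj f v = (f' == f)%:R *: v.
Proof.
move=> f'v; rewrite /joint_proj.
have -> : (f' == f) = all (fun i => f' i == f i) (enum I).
  apply/eqP/allP => [-> i _ //|ff']; apply/ffunP => i; apply/eqP/ff'.
  by rewrite mem_enum.
elim: (enum I) => [|i l IHl] /=; first by rewrite scale1r.
rewrite IHl; case: all; last by rewrite andbF !scale0r E0.
by rewrite andbT scale1r (joint_eigenE _ _ f'v).
Qed.

End JointEigenspaces.

Section Gradation.
Variables (k : fieldType) (V : lmodType k) (I : finType) (W : I -> {pred V}).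

Lemma gradation_proj : gradation W -> exists pi : I -> {linear V -> V},
  [/\ forall i v, pi i v \in W i, forall v, v = \sum_i pi i v
    & forall i j v, v \in W j -> pi i v = (i == j)%:R *: v].
Proof.
case=> Wsub /choice[w wP].
have wW v i : w v i \in W i by case: (wP v) => -[].
have w_sum v : v = \sum_i w v i by case: (wP v) => -[].
have w_uniq v (u : {ffun I -> V}) : (forall i, u i \in W i) ->
  v = \sum_i u i -> w v = u by move=> uW vu; case: (wP v) => _; apply.
have w_lin i : linear (fun v => w v i).
  move=> a u v; rewrite (w_uniq _ [ffun j => a *: w u j + w v j]) ?ffunE //.
    by move=> j; rewrite ffunE (proj2 (Wsub j)).
  rewrite {1}(w_sum u) {1}(w_sum v) scaler_sumr -big_split.
  by apply: eq_bigr => j _; rewrite ffunE.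
have [pi piE] := choice (fun i => linear_ex (w_lin i)).
exists pi; split=> [i v|v|i j v vW]; first by rewrite piE.
  by rewrite {1}(w_sum v); apply: eq_bigr => i _; rewrite piE.
rewrite piE (w_uniq _ [ffun i => (i == j)%:R *: v]) ?ffunE // => [i'|].
  rewrite ffunE; have [->|_] := eqVneq i' j; first by rewrite scale1r.
  by rewrite scale0r (proj1 (Wsub i')).
under eq_bigr => i' _ do rewrite ffunE eq_sym.
by rewrite (sum_delta j (fun=> v)).
Qed.

End Gradation.

(** The Gaussian binomial coefficient [m choose j]_r, by a q-Pascal rule. The truncated subtraction
    [m' - j'] is harmless: for m' < j' the factor beside it vanishes. *)
Fixpoint gauss_bin (k : fieldType) (r : k) (m j : nat) : k :=
  match m, j with
  | _, 0 => 1
  | 0, _.+1 => 0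
  | m'.+1, j'.+1 => gauss_bin r m' j'.+1 + r ^+ (m' - j') * gauss_bin r m' j'
  end.

Section QBinomial.
Variables (k : fieldType) (r : k).

Lemma gauss_bin0 m : gauss_bin r m 0 = 1. Proof. by case: m. Qed.

Lemma gauss_bin_small m j : (m < j)%N -> gauss_bin r m j = 0.
Proof.
elim: m j => [|m IHm] [|j] //= mj.
by rewrite !IHm ?mulr0 ?addr0 // ltnW.
Qed.

(** This is the geometric sum 1 + r + ... + r^(m-1); multiplied by r - 1 it gives r^m - 1, nonzero
    because m lies below the order n. *)
Lemma gauss_bin1_neq0 n m :
  n.-primitive_root r -> (0 < m < n)%N -> gauss_bin r m 1 != 0.
Proof.
move=> rn /andP[m0 mn].
have gauss_bin1 : (r - 1) * gauss_bin r m 1 = r ^+ m - 1.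
  elim: {m0 mn} m => [|m IHm]; first by rewrite mulr0 expr0 subrr.
  rewrite [gauss_bin _ _ _]/= subn0 gauss_bin0 mulr1 mulrDr IHm mulrBl mul1r.
  by rewrite -exprS addrC addrA subrK.
apply: contraTneq isT => q0; move: gauss_bin1; rewrite q0 mulr0 => /esym/eqP.
rewrite subr_eq0 -(prim_order_dvd rn) => /(dvdn_leq m0).
by rewrite leqNgt mn.
Qed.

End QBinomial.

(** * Structure maps of H_D on the basis g x^i *)

Section BraidedProduct.
Variables (k : fieldType) (H : braidedBialgebra k).

Lemma comulM_tens (a b c d : H) r : braid (b *t c) = r *: (c *t b) ->
  tmap tmul tmul (tmid braid ((a *t b) *t (c *t d))) =
  r *: ((a * c) *t (b * d)).
Proof.
move=> bc; rewrite tmidE tapp23E bc linearZr_LR /= !linearZ /= tassocVE.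
by rewrite linearZl_LR !linearZ /= tassocE tmapE /= !tmulE.
Qed.

Lemma comulME (a b : H) :
  comul (a * b) = tmap tmul tmul (tmid braid (comul a *t comul b)).
Proof. by rewrite -[a * b]tmulE [LHS]comulM /= tmapE. Qed.

End BraidedProduct.

Section HDStructure.
Variables (k : fieldType) (gT : finGroupType) (chi : gT -> k) (z : gT).
Variables (lambda q : k) (n : nat).
Hypothesis chi_char : mult_char chi.
Hypothesis n_gt1 : (1 < n)%N.
Hypothesis qp_order : n.-primitive_root (q * chi z).
Variables (H : braidedHopf k) (iota : gT -> H) (x : H).
Hypothesis H_is_HD : is_HD chi z lambda q n iota x.

Definition HDe (b : gT * 'I_n) : H := iota b.1 * x ^+ b.2.

(** The inverse of the coordinate bijection is linear because that bijection is; its components form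
    the basis dual to [HDe]. *)
Lemma HDe_coords : exists co : gT * 'I_n -> {linear H -> k^o},
  (forall i j, co i (HDe j) = (i == j)%:R) /\
  (forall h, h = \sum_i (co i h : k) *: HDe i).
Proof.
have [K] := HD_basis H_is_HD.
pose f (a : {ffun gT * 'I_n -> k}) : H := \sum_b a b *: HDe b.
rewrite -/f => fK Kf.
have f_lin (a : k) (u v : {ffun gT * 'I_n -> k}) :
    f [ffun b => a * u b + v b] = a *: f u + f v.
  rewrite /f scaler_sumr -big_split; apply: eq_bigr => b _ /=.
  by rewrite ffunE scalerDl scalerA.
have co_ex (b : gT * 'I_n) : exists c : {linear H -> k^o}, c =1 (K^~ b).
  apply: (@linear_ex k H k^o (K^~ b)) => a u v.
  by rewrite -{1}[u]Kf -{1}[v]Kf -f_lin fK ffunE.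
have [co coK] := choice co_ex; exists co; split=> [i j|h].
  rewrite coK -[HDe j](_ : f [ffun b => (b == j)%:R] = _) ?fK ?ffunE //.
  rewrite /f (bigD1 j) //= ffunE eqxx scale1r big1 ?addr0 // => b /negPf bj.
  by rewrite ffunE bj scale0r.
by rewrite -{1}[h]Kf; apply: eq_bigr => i _; rewrite coK.
Qed.

Lemma iotaX g m : iota (g ^+ m)%g = iota g ^+ m.
Proof.
elim: m => [|m IHm]; first by rewrite expg0 expr0 (HD_iota1 H_is_HD).
by rewrite expgS exprS (HD_iotaM H_is_HD) IHm.
Qed.

Lemma expx_iota m g : x ^+ m * iota g = chi g ^+ m *: (iota g * x ^+ m).
Proof.
elim: m => [|m IHm]; first by rewrite !expr0 scale1r mul1r mulr1.
rewrite exprSr -mulrA (HD_xg H_is_HD) -scalerAr !mulrA IHm.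
by rewrite -scalerAl scalerA -exprS.
Qed.

Lemma HDe_mul g h i j : (iota g * x ^+ i) * (iota h * x ^+ j) =
  chi h ^+ i *: (iota (g * h)%g * x ^+ (i + j)).
Proof.
rewrite mulrA -[_ * _ * iota h]mulrA expx_iota -scalerAr -scalerAl exprD.
by rewrite !mulrA (HD_iotaM H_is_HD).
Qed.

Lemma counit_HDe g i : counit (iota g * x ^+ i) = (i == 0%N)%:R.
Proof.
rewrite counitM (HD_counit_iota H_is_HD) mul1r.
case: i => [|i]; first by rewrite expr0 counit1.
by rewrite exprS counitM (HD_counit_x H_is_HD) mul0r.
Qed.

Lemma braid_x g i : (i < n)%N ->
  braid ((iota g * x ^+ i) *t x) = q ^+ i *: (x *t (iota g * x ^+ i)).
Proof.
move=> i_n; have := HD_braid H_is_HD g 1%g (Ordinal i_n) (Ordinal n_gt1).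
by rewrite (HD_iota1 H_is_HD) /= mul1r expr1 muln1.
Qed.

(** Multiplying Delta(g x^m) by 1 ⊗ x and x ⊗ z gives the two terms of the q-Pascal rule: the braid
    moves x past x^(m-j) at the cost of q^(m-j), and moving x^(m-j) past z costs chi(z)^(m-j). The
    bound m < n keeps the powers in the range where the braid is given. *)
Lemma comul_HDe g m : (m < n)%N ->
  comul (iota g * x ^+ m) = \sum_(j < m.+1) gauss_bin (q * chi z) m j *:
    ((iota g * x ^+ j) *t (iota (g * z ^+ j)%g * x ^+ (m - j))).
Proof.
set r := q * chi z.
elim: m => [|m IHm] m_n.
  rewrite expr0 mulr1 (HD_comul_iota H_is_HD) big_ord1 /= scale1r expg0 mulg1.
  by rewrite ?expr0 ?mulr1.
pose X (i j : nat) := (iota g * x ^+ i) *t (iota (g * z ^+ i)%g * x ^+ j).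
rewrite exprSr mulrA comulME (IHm (ltnW m_n)) (HD_comul_x H_is_HD).
have step (j : 'I_m.+1) :
    tmap tmul tmul (tmid braid (X j (m - j)%N *t (1 *t x + x *t iota z))) =
    X j (m.+1 - j)%N + r ^+ (m - j) *: X j.+1 (m - j)%N.
  rewrite linearDr !linearD /=; congr (_ + _).
    rewrite (@comulM_tens _ _ _ _ _ _ 1) ?braid1r ?scale1r //.
    by rewrite mulr1 -mulrA -exprSr subSn // -ltnS.
  rewrite (comulM_tens _ _ (braid_x _ _)); last first.
    by rewrite (leq_ltn_trans (leq_subr _ _)) // ltnW.
  rewrite -!mulrA -exprSr expx_iota -scalerAr mulrA -(HD_iotaM H_is_HD) -mulgA.
  by rewrite -expgSr linearZr_LR /= scalerA -exprMn.
rewrite linear_sumlz !linear_sum /=.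
under eq_bigr => j _.
  rewrite linearZl_LR !linearZ /= -/(X j (m - j)%N) step scalerDr scalerA.
  over.
rewrite big_split /= [RHS]big_ord_recl /= scale1r.
rewrite [X in X + _](_ : _ =
    \sum_(j < m.+2) gauss_bin r m j *: X j (m.+1 - j)%N).
  rewrite big_ord_recl /= gauss_bin0 scale1r /X -addrA; congr (_ + _).
  rewrite -big_split; apply: eq_bigr => j _ /=.
  by rewrite -![bump 0 j]/(j.+1) subSS scalerDl (mulrC (gauss_bin r m j)).
by rewrite [RHS]big_ord_recr /= gauss_bin_small // scale0r addr0.
Qed.

Variable co : gT * 'I_n -> {linear H -> k^o}.
Hypothesis coE : forall i j, co i (HDe j) = (i == j)%:R.
Hypothesis co_sum : forall h, h = \sum_i (co i h : k) *: HDe i.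
Variable V : lmodType k.

Lemma co_iotaX b g m : (m < n)%N ->
  co b (iota g * x ^+ m) = ((b.1 == g) && (b.2 == m :> nat))%:R.
Proof. by move=> mn; rewrite -[_ * _]/(HDe (g, Ordinal mn)) coE; case: b. Qed.

(** By [comul_HDe] only the basis element h x^(j+l) can contribute to h x^j ⊗ h' x^l, and only for
    h' = h z^j. *)
Lemma corr_comul (t : V ⊗ H) h h' (j l m : 'I_n) : m = (j + l)%N :> nat ->
  corr co (h, j) (h', l) (tassocV (tmap idfun comul t)) =
  (h' == h * z ^+ j)%g%:R *: (gauss_bin (q * chi z) m j *: cor co (h, m) t).
Proof.
move=> mjl; set d := _%:R; set c := gauss_bin _ _ _.
pose f : {linear V ⊗ H -> V} :=
  corr co (h, j) (h', l) \o tassocV \o tmap idfun comul.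
pose g : {linear V ⊗ H -> V} := d \*: (c \*: cor co (h, m)).
suff: f =1 g by apply.
apply: (tensor_basis_ext_l co_sum) => -[u i] v; rewrite /f /g /=.
rewrite corE tmapE /= comul_HDe // linear_sumr !linear_sum /=.
have term (p : 'I_i.+1) :
    corr co (h, j) (h', l) (tassocV (v *t (gauss_bin (q * chi z) i p *:
      (iota u * x ^+ p *t (iota (u * z ^+ p)%g * x ^+ (i - p)))))) =
    (((h' == u * z ^+ p)%g && (l == i - p :> nat)%N) &&
      ((h == u) && (j == p :> nat)))%:R *: (gauss_bin (q * chi z) i p *: v).
  rewrite linearZr_LR !linearZ /= tassocVE corrE corE !co_iotaX /=.
  - by rewrite !scalerA -natrM mulnb mulrC.
  - by rewrite (leq_ltn_trans _ (ltn_ord i)) // -ltnS.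
  - by rewrite (leq_ltn_trans (leq_subr _ _)).
under eq_bigr => p _ do rewrite term.
rewrite coE xpair_eqE; have [hu|] := eqVneq h u; last first.
  by rewrite scale0r !scaler0 big1 // => p _; rewrite andbF scale0r.
have [im|] := eqVneq m i; last first.
  rewrite scale0r !scaler0 => mi; rewrite big1 // => p _.
  case: andP; rewrite ?scale0r // => -[/andP[_ /eqP lip] /andP[_ /eqP jp]].
  by case/eqP: mi; apply/val_inj; rewrite /= mjl lip jp subnKC // -ltnS.
have ji : (j < i.+1)%N by rewrite ltnS -im mjl leq_addr.
rewrite (bigD1 (Ordinal ji)) //= big1 ?addr0 => [|p].
  rewrite !eqxx -im mjl addKn eqxx !andbT scale1r /d.
  by rewrite -hu /c -mjl im; case: eqVneq => _; rewrite ?scale1r ?scale0r.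
by rewrite -(inj_eq val_inj) eq_sym /= => /negPf ->; rewrite !andbF scale0r.
Qed.

Lemma corr_braid (t : V ⊗ H ⊗ H) b b' :
  corr co b' b (tapp23 braid t) = q ^+ (b.2 * b'.2) *: corr co b b' t.
Proof.
pose f : {linear V ⊗ H ⊗ H -> V} := corr co b' b \o tapp23 braid.
pose g : {linear V ⊗ H ⊗ H -> V} := q ^+ (b.2 * b'.2) \*: corr co b b'.
suff: f =1 g by apply.
apply: (tensor3_basis_ext_l co_sum) => v [u i] [u' i']; rewrite /f /g {f g} /=.
rewrite tapp23E (HD_braid H_is_HD) linearZr_LR !linearZ /= tassocVE.
rewrite -/(HDe (u, i)) -/(HDe (u', i')) !corrE !corE !coE.
rewrite !scalerA; congr (_ *: _).
by case: eqP => [->|_]; case: eqP => [->|_]; rewrite ?mul0r ?mulr0.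
Qed.

(** * The coefficients T(a, b) and the identities the axioms impose *)

Section Coefficients.
Variable s : {linear H ⊗ V -> V ⊗ H}.

(** This is T(a, b), with [a] any element of [H] rather than a basis element, so that relations
    among products can be evaluated. *)
Definition coef (a : H) (b : gT * 'I_n) (v : V) : V := cor co b (s (a *t v)).

Lemma coef_sum a v : s (a *t v) = \sum_b coef a b v *t HDe b.
Proof. exact: (cor_sum co_sum). Qed.

Lemma coefP a b c : {morph coef a b : u v / c *: u + v}.
Proof. by move=> u v; rewrite /coef linearPr !linearP. Qed.

Lemma coef_sumr a b J (r : seq J) (P : pred J) (v : J -> V) :
  coef a b (\sum_(j <- r | P j) v j) = \sum_(j <- r | P j) coef a b (v j).
Proof. by rewrite /coef linear_sumr !linear_sum. Qed.

Lemma coefZ a b c v : coef a b (c *: v) = c *: coef a b v.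
Proof. by rewrite /coef linearZr_LR !linearZ. Qed.

Lemma coef0 a b : coef a b 0 = 0.
Proof. by rewrite /coef linear0r !linear0. Qed.

Lemma coefZl a b c v : coef (c *: a) b v = c *: coef a b v.
Proof. by rewrite /coef linearZl_LR !linearZ. Qed.

Lemma corr_coef a a' b b' v :
  corr co b b' (tapp12 s (tapp23 s (a *t a' *t v))) = coef a b (coef a' b' v).
Proof.
rewrite tapp23E coef_sum linear_sumr !linear_sum /=.
rewrite -[RHS](sum_delta b' (fun c => coef a b (coef a' c v))).
apply: eq_bigr => c _; rewrite tassocVE tapp12E corrE coE.
by [].
Qed.

Hypothesis s_space : left_space s.

Lemma space_ext (t t' : H ⊗ V) : s t = s t' -> t = t'.
Proof. exact: (bij_inj (left_space_bij s_space)). Qed.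

Lemma space_mul a a' b b' v v' v'' :
  s (a' *t v) = v' *t b' -> s (a *t v') = v'' *t b ->
  s ((a * a') *t v) = v'' *t (b * b').
Proof.
move=> sa' sa; have -> : s ((a * a') *t v) =
    (s \o tmap tmul idfun) (a *t a' *t v) by rewrite /= tmapE /= tmulE.
rewrite (left_spaceM s_space) /= tapp23E sa' tassocVE tapp12E sa tassocE.
by rewrite tmapE /= tmulE.
Qed.

Lemma coef_counit g v :
  \sum_h coef (iota g) (h, Ordinal (ltnW n_gt1)) v = v.
Proof.
have := left_space_counit s_space (iota g *t v).
rewrite /= tmapE tscalelE (HD_counit_iota H_is_HD) scale1r /= => {2}<-.
rewrite coef_sum !linear_sum /=.
pose F h (i : 'I_n) := (i == 0 :> nat)%:R *: coef (iota g) (h, i) v.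
rewrite (eq_bigr (fun b : gT * 'I_n => F b.1 b.2)).
  rewrite -(pair_bigA _ F) /F /=.
  apply: eq_bigr => h _; rewrite (bigD1 (Ordinal (ltnW n_gt1))) //= scale1r.
  rewrite big1 ?addr0 // => i; rewrite -(inj_eq val_inj) /= => /negPf ->.
  by rewrite scale0r.
move=> [h i] _; rewrite tmapE /= tscalerE; congr (_ *: _).
exact: counit_HDe.
Qed.

(** Both sides are the coefficient of h x^j ⊗ h' x^l in the compatibility of s with Delta, at the
    group-like g. *)
Lemma coef_iota g h h' (j l m : 'I_n) v : m = (j + l)%N :> nat ->
  coef (iota g) (h, j) (coef (iota g) (h', l) v) =
  (h' == h * z ^+ j)%g%:R *:
    (gauss_bin (q * chi z) m j *: coef (iota g) (h, m) v).
Proof.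
move=> mjl; rewrite -(corr_comul _ _ _ mjl).
have /= -> := left_space_comul s_space (iota g *t v).
by rewrite tmapE (HD_comul_iota H_is_HD) corr_coef.
Qed.

(** The same comparison at x. The first summand comes from 1 ⊗ x, the second from x ⊗ z; T(1, -) is
    the identity at the basis element 1 and zero elsewhere. *)
Lemma coef_x h h' (j l m : 'I_n) v : m = (j + l)%N :> nat ->
  ((h == 1%g) && (j == 0 :> nat)%N)%:R *: coef x (h', l) v
    + coef x (h, j) (coef (iota z) (h', l) v) =
  (h' == h * z ^+ j)%g%:R *: (gauss_bin (q * chi z) m j *: coef x (h, m) v).
Proof.
move=> mjl; rewrite -(corr_comul _ _ _ mjl).
have /= -> := left_space_comul s_space (x *t v).
rewrite tmapE (HD_comul_x H_is_HD) linearDl !linearD /= !corr_coef.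
congr (_ + _); rewrite [coef 1 _ _]/coef (left_space1 s_space) corE.
have -> : 1 = iota 1%g * x ^+ 0 by rewrite (HD_iota1 H_is_HD) mul1r.
by rewrite co_iotaX ?(ltnW n_gt1).
Qed.

Lemma coef_braid (b1 b2 c1 c2 : gT * 'I_n) v :
  q ^+ (b1.2 * b2.2) *: coef (HDe b2) c2 (coef (HDe b1) c1 v) =
  q ^+ (c1.2 * c2.2) *: coef (HDe b1) c1 (coef (HDe b2) c2 v).
Proof.
have /(congr1 (corr co c2 c1)) :=
  left_space_braid s_space (HDe b1 *t HDe b2 *t v).
rewrite [LHS]/= [in LHS]tapp12E (HD_braid H_is_HD) linearZl_LR !linearZ /=.
by rewrite corr_coef => ->; rewrite corr_braid corr_coef.
Qed.

Local Notation o0 := (Ordinal (ltnW n_gt1)).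
Local Notation o1 := (Ordinal n_gt1).

Lemma HDe0 g : HDe (g, o0) = iota g.
Proof. by rewrite /HDe /= mulr1. Qed.

Lemma HDe1 : HDe (1%g, o1) = x.
Proof. by rewrite /HDe /= (HD_iota1 H_is_HD) mul1r. Qed.

Lemma coef_braid_iota g (b c c' : gT * 'I_n) v :
  coef (iota g) c' (coef (HDe b) c v) =
  q ^+ (c.2 * c'.2) *: coef (HDe b) c (coef (iota g) c' v).
Proof. by have := coef_braid b (g, o0) c c' v; rewrite HDe0 muln0 scale1r. Qed.

Lemma coef_iota_comm g h b c v :
  coef (iota g) (h, o0) (coef (HDe b) c v) =
  coef (HDe b) c (coef (iota g) (h, o0) v).
Proof. by rewrite coef_braid_iota muln0 scale1r. Qed.

(** With [coef_mul_tensl] this evaluates the two sides of x g = chi(g) g x: each lemma treats a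
    product one of whose factors is already known to transpose by a pure tensor. *)
Lemma coef_mul_tensr a a' b b' v w : s (a' *t v) = w *t b' ->
  coef (a * a') b v = \sum_c (co b (HDe c * b') : k) *: coef a c w.
Proof.
move=> sa'; have -> : coef (a * a') b v =
    cor co b ((s \o tmap tmul idfun) (a *t a' *t v)).
  by rewrite /= tmapE /= tmulE.
rewrite (left_spaceM s_space) /= tapp23E sa' tassocVE tapp12E coef_sum.
rewrite linear_sumlz !linear_sum /=; apply: eq_bigr => c _.
by rewrite tassocE tmapE /= tmulE corE.
Qed.

Lemma coef_mul_tensl a a' b b' v (w : gT * 'I_n -> V) :
    (forall c, s (a *t coef a' c v) = w c *t b') ->
  coef (a * a') b v = \sum_c (co b (b' * HDe c) : k) *: w c.
Proof.
move=> sa; have -> : coef (a * a') b v =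
    cor co b ((s \o tmap tmul idfun) (a *t a' *t v)).
  by rewrite /= tmapE /= tmulE.
rewrite (left_spaceM s_space) /= tapp23E coef_sum linear_sumr !linear_sum /=.
apply: eq_bigr => c _.
by rewrite tassocVE tapp12E sa tassocE tmapE /= tmulE corE.
Qed.

Lemma coef_iota_idem g h h' v :
  coef (iota g) (h, o0) (coef (iota g) (h', o0) v) =
  (h' == h)%:R *: coef (iota g) (h, o0) v.
Proof.
by rewrite (@coef_iota g h h' o0 o0 o0) //= mulg1 scale1r.
Qed.

Lemma coef_iota_deg0 g h l v :
  coef (iota g) (h, o0) (coef (iota g) (h, l) v) = coef (iota g) (h, l) v.
Proof.
by rewrite (@coef_iota g h h o0 l l) //= mulg1 eqxx gauss_bin0 !scale1r.
Qed.

Lemma ord_pos (l : 'I_n) : l != o0 -> (0 < l)%N.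
Proof. by rewrite lt0n. Qed.

(** [coef_iota] and [coef_x] with j = 1 express degree l, up to this scalar, through degrees 1 and l
    - 1; its nonvanishing allows the division. *)
Lemma pos_ord (l : 'I_n) : (0 < l)%N ->
  exists2 l' : 'I_n, l = (1 + l')%N :> nat & gauss_bin (q * chi z) l 1 != 0.
Proof.
case: l => -[|l] // ln _; exists (Ordinal (ltnW ln)) => //.
by apply: (gauss_bin1_neq0 qp_order).
Qed.

Lemma coef_iota_deg1 g h (l : 'I_n) v :
  (forall h' u, coef (iota g) (h', o1) u = 0) -> (0 < l)%N ->
  coef (iota g) (h, l) v = 0.
Proof.
move=> g1 /pos_ord[l' ll' ql].
have := coef_iota g h (h * z)%g v (ll' : l = (o1 + l')%N :> nat).
rewrite g1 /= expg1 eqxx scale1r => /esym/eqP.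
by rewrite scaler_eq0 (negPf ql) => /eqP.
Qed.

Lemma coef_iota_z_neq1 g h (l : 'I_n) v : z != 1%g -> (0 < l)%N ->
  coef (iota g) (h, l) v = 0.
Proof.
move=> z1; apply: coef_iota_deg1 => {}h {}v.
(* T(g, h x) = T(g, h) T(g, h x) = T(g, h x) T(g, h), and the last product vanishes unless h = h
   z. *)
rewrite -coef_iota_deg0; have := coef_iota_comm g h (g, o0) (h, o1) v.
rewrite HDe0 => ->.
rewrite (@coef_iota g h h o1 o0 o1) //= expg1.
by rewrite -{1}[h]mulg1 (inj_eq (mulgI h)) eq_sym (negPf z1) scale0r.
Qed.

Lemma coef_z h (l : 'I_n) v : (0 < l)%N -> coef (iota z) (h, l) v = 0.
Proof.
move=> l0; have [z1|/coef_iota_z_neq1] := eqVneq z 1%g; last exact.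
rewrite z1 (HD_iota1 H_is_HD) /coef (left_space1 s_space) corE.
have -> : 1 = iota 1%g * x ^+ 0 by rewrite (HD_iota1 H_is_HD) mul1r.
rewrite co_iotaX ?(ltnW n_gt1) //=.
by rewrite eqn0Ngt l0 andbF scale0r.
Qed.

(** * The transposition of x, and vanishing in positive degree *)

Local Notation P := (coef x (1%g, o0)).
Local Notation Q := (coef x (1%g, o1)).

(** Take j = 1 in [coef_x]: the first summand vanishes because j is not 0, the second because T(z,
    -) vanishes in the positive degree l - 1. *)
Lemma coef_x_deg2 h (l : 'I_n) v : (1 < l)%N -> coef x (h, l) v = 0.
Proof.
move=> l1; have [l' ll' ql] := pos_ord (ltnW l1).
have l'0 : (0 < l')%N by rewrite ll' ltnS in l1.
have := coef_x h (h * z)%g v (ll' : l = (o1 + l')%N :> nat).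
rewrite coef_z // coef0 addr0 /= andbF scale0r expg1 eqxx scale1r => /esym/eqP.
by rewrite scaler_eq0 (negPf ql) => /eqP.
Qed.

(** This and the next three lemmas are [coef_x] with first group element 1 and (j, l) = (0, 1), (0,
    0), (0, 0), (1, 0). *)
Lemma coef_x_deg1 h v : h != 1%g -> coef x (h, o1) v = 0.
Proof.
move=> h1; have := @coef_x 1%g h o0 o1 o1 v erefl.
rewrite coef_z // coef0 addr0 /= !eqxx !scale1r expg0 mulg1 (negPf h1) => ->.
by rewrite scale0r.
Qed.

Lemma coef_x_deg0 h v : h != 1%g ->
  coef x (h, o0) v = - P (coef (iota z) (h, o0) v).
Proof.
move=> h1; have := @coef_x 1%g h o0 o0 o0 v erefl.
rewrite /= !eqxx !scale1r expg0 mulg1 (negPf h1) scale0r => /eqP.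
by rewrite addr_eq0 => /eqP.
Qed.

Lemma P_z1 v : P (coef (iota z) (1%g, o0) v) = 0.
Proof.
have := @coef_x 1%g 1%g o0 o0 o0 v erefl.
rewrite /= !eqxx !scale1r expg0 mulg1 ?eqxx ?gauss_bin0 !scale1r => /eqP.
by rewrite -[X in _ == X]addr0 (inj_eq (addrI _)) => /eqP.
Qed.

Lemma Q_z h v : h != z -> Q (coef (iota z) (h, o0) v) = 0.
Proof.
move=> hz; have := @coef_x 1%g h o1 o0 o1 v erefl.
by rewrite /= andbF scale0r add0r expg1 mul1g (negPf hz) scale0r.
Qed.

Lemma s_z_eigen h v :
  let w := coef (iota z) (h, o0) v in s (iota z *t w) = w *t iota h.
Proof.
move=> w; rewrite coef_sum (bigD1 (h, o0)) //= HDe0 big1 ?addr0.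
  by rewrite coef_iota_idem eqxx scale1r.
move=> [u l] /=; have [->|l0] := eqVneq l o0; last first.
  by rewrite coef_z ?linear0l ?ord_pos.
rewrite xpair_eqE eqxx andbT coef_iota_idem eq_sym => /negPf ->.
by rewrite scale0r linear0l.
Qed.

Lemma coef_iota_comm_x g h c v :
  coef (iota g) (h, o0) (coef x c v) = coef x c (coef (iota g) (h, o0) v).
Proof. by have := coef_iota_comm g h (1%g, o1) c v; rewrite HDe1. Qed.

Lemma co_HDe_iota u c : co (u, o0) (HDe c * iota u) = ((1%g, o0) == c)%:R.
Proof.
case: c => h l; rewrite /HDe -mulrA expx_iota -scalerAr mulrA.
rewrite -(HD_iotaM H_is_HD) linearZ co_iotaX //= xpair_eqE.
have -> : (u == h * u)%g = (1 == h)%g.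
  by apply/eqP/eqP=> [|<-]; rewrite ?mul1g // -{1}[u]mul1g => /mulIg.
rewrite -(inj_eq val_inj) /=.
by have [<-|_] := 0%N =P l :> nat; rewrite ?scale1r // andbF scaler0.
Qed.

Lemma co_iota_HDe u c : co (u, o0) (iota u * HDe c) = ((1%g, o0) == c)%:R.
Proof.
case: c => h l; rewrite /HDe mulrA -(HD_iotaM H_is_HD) co_iotaX //= xpair_eqE.
by rewrite -{1}[u]mulg1 (inj_eq (mulgI u)) -(inj_eq val_inj).
Qed.

Hypothesis pq : (chi z, q) != (1, -1).

Lemma q_neq : chi z = 1 -> (q != 1) && (q != -1).
Proof.
move=> p1; move: qp_order pq; rewrite p1 mulr1 xpair_eqE eqxx => qn -> /=.
rewrite andbT; apply: contraTneq n_gt1 => q1; rewrite -leqNgt.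
by apply: dvdn_leq => //; rewrite (prim_order_dvd qn) q1 expr1.
Qed.

Lemma P0 v : P v = 0.
Proof.
have [p1|p1] := eqVneq (chi z) 1; last first.
  (* Decompose v by the T(z, u). On w = T(z, u) v with u <> 1, z transposes to u, so the coefficient
     of u in s(xz ⊗ w) = p s(zx ⊗ w) reads P w = p P w. *)
  rewrite -(coef_counit z v) coef_sumr big1 // => u _.
  have [->|u1] := eqVneq u 1%g; first exact: P_z1.
  set w := coef (iota z) _ _; have sw := s_z_eigen u v; rewrite -/w /= in sw.
  have sxw c : s (iota z *t coef x c w) = coef x c w *t iota u.
    by rewrite /w -coef_iota_comm_x; exact: (s_z_eigen u (coef x c v)).
  have := coefZl (iota z * x) (u, o0) (chi z) w.
  rewrite -(HD_xg H_is_HD) (coef_mul_tensr _ _ sw) (coef_mul_tensl _ sxw).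
  under eq_bigr => c _ do rewrite co_HDe_iota.
  under [X in _ = _ *: X]eq_bigr => c _ do rewrite co_iota_HDe.
  rewrite !(sum_delta _ (fun c => coef x c w)) -[LHS]scale1r => /eqP.
  rewrite -subr_eq0 -scalerBl scaler_eq0 subr_eq0 eq_sym (negPf p1) /=.
  by move/eqP.
have /andP[q1 qN1] := q_neq p1.
(* The braid identity at (x, x) gives q PP = PP and, for the two orders of the targets 1 and x, q QP
   = PQ and q PQ = QP. *)
have PP u : P (P u) = 0.
  have /= /eqP := coef_braid (1%g, o1) (1%g, o1) (1%g, o0) (1%g, o0) u.
  rewrite HDe1 expr1 scale1r -subr_eq0 -{2}[P (P u)]scale1r -scalerBl.
  by rewrite scaler_eq0 subr_eq0 (negPf q1) => /eqP.
have QP u : Q (P u) = 0.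
  have /= := coef_braid (1%g, o1) (1%g, o1) (1%g, o0) (1%g, o1) u.
  have /= := coef_braid (1%g, o1) (1%g, o1) (1%g, o1) (1%g, o0) u.
  rewrite HDe1 !expr1 !scale1r => qPQ qQP; apply/eqP.
  have: (q ^+ 2 - 1) *: Q (P u) = 0.
    by rewrite scalerBl scale1r expr2 -scalerA qQP qPQ subrr.
  by move/eqP; rewrite scaler_eq0 subr_eq0 sqrf_eq1 (negPf q1) (negPf qN1).
(* As s is injective, it suffices that all coefficients of s(x ⊗ P v) vanish: degree 1 involves QP,
   and degree 0 involves PP up to sign and a factor T(z, h). *)
apply: (tens_basis_eq0 coE (i := (1%g, o1))); rewrite HDe1.
apply: space_ext; rewrite linear0; apply: (cor_inj co_sum) => -[h l].
rewrite linear0 -[LHS]/(coef x (h, l) (P v)).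
have [l1|] := ltnP 1 l; first exact: coef_x_deg2.
rewrite leq_eqVlt ltnS leqn0 => /orP[/eqP l1|/eqP l0].
  have -> : l = o1 by apply/val_inj.
  by have [->|/coef_x_deg1 ->] := eqVneq h 1%g; rewrite ?QP.
have -> : l = o0 by apply/val_inj.
have [->|/coef_x_deg0 ->] := eqVneq h 1%g; first exact: PP.
by rewrite coef_iota_comm_x PP oppr0.
Qed.

Lemma coef_x_eq0 c v : c != (1%g, o1) -> coef x c v = 0.
Proof.
case: c => h l; rewrite xpair_eqE negb_and.
have [l1 _|l1] := ltnP 1 l; first exact: coef_x_deg2.
have [->|l0] := eqVneq l o1; first by rewrite orbF; apply: coef_x_deg1.
have -> : l = o0.
  apply/val_inj/eqP; rewrite -[_ == _]/(l == 0 :> nat)%N.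
  by rewrite -leqn0 -ltnS ltn_neqAle l1 andbT.
have [->|h1 _] := eqVneq h 1%g; first by rewrite P0.
by rewrite coef_x_deg0 // P0 oppr0.
Qed.

Lemma s_x v : s (x *t v) = Q v *t x.
Proof.
rewrite coef_sum (bigD1 (1%g, o1)) //= HDe1 big1 ?addr0 // => c /coef_x_eq0 ->.
by rewrite linear0l.
Qed.

Lemma Q_inj : injective Q.
Proof.
move=> u v Quv; have: s (x *t u) = s (x *t v) by rewrite !s_x Quv.
move/space_ext/(congr1 (col co (1%g, o1))).
by rewrite !colE -HDe1 coE eqxx !scale1r.
Qed.

Lemma Q_eq0 v : Q v = 0 -> v = 0.
Proof. by move=> Qv; apply: Q_inj; rewrite Qv coef0. Qed.

(** When [HDe c] has exponent n - 1 the product wraps to a multiple of z^n - 1, which lies in degree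
    0 and so misses degree m + 1. *)
Lemma co_HDe_x h (m : 'I_n) (mn : (m.+1 < n)%N) c :
  co (h, Ordinal mn) (HDe c * x) = ((h, m) == c)%:R.
Proof.
case: c => g l; rewrite /HDe -mulrA -exprSr /= xpair_eqE.
have [ln|] := ltnP l.+1 n; first by rewrite co_iotaX.
rewrite leq_eqVlt ltnS leqNgt ltn_ord orbF => /eqP nl.
have -> : (m == l) = false.
  by apply/eqP => ml; move: mn; rewrite ml -nl ltnn.
rewrite -nl (HD_xn H_is_HD) -scalerAr mulrBr mulr1 -(HD_iotaM H_is_HD) andbF.
have iX0 u : iota u = iota u * x ^+ 0 by rewrite mulr1.
rewrite (iX0 g) (iX0 (g * _)%g) linearZ linearB /= !co_iotaX ?(ltnW n_gt1) //.
by rewrite !andbF subrr scaler0.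
Qed.

(** Compare the coefficients of h x^(m+1) in s(xg ⊗ v) = chi(g) s(gx ⊗ v): chi(h) Q T(g, h x^m) v on
    one side, chi(g) T(g, h x^m) Q v on the other. The braid identity moves Q to the front at the
    cost of q^m, and Q is injective. *)
Lemma coef_iota_chi g h (m : 'I_n) v : (m.+1 < n)%N ->
  coef (iota g) (h, m) v != 0 -> chi h = chi g * q ^+ m.
Proof.
move=> mn; apply: contraNeq => chi_h; apply/eqP/Q_eq0/eqP.
have gx : coef (iota g) (h, m) (Q v) = q ^+ m *: Q (coef (iota g) (h, m) v).
  have := coef_braid_iota g (1%g, o1) (1%g, o1) (h, m) v.
  by rewrite HDe1 mul1n.
have sgx c : s (x *t coef (iota g) c v) = Q (coef (iota g) c v) *t x.
  exact: s_x.
have := coefZl (iota g * x) (h, Ordinal mn) (chi g) v.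
rewrite -(HD_xg H_is_HD) (coef_mul_tensr _ _ (s_x v)) (coef_mul_tensl _ sgx).
under [X in _ = _ *: X]eq_bigr => c _ do rewrite co_HDe_x.
rewrite (sum_delta _ (fun c => coef (iota g) c (Q v))) gx scalerA.
rewrite (eq_bigr (fun c => chi h *: (((h, m) == c)%:R *:
    Q (coef (iota g) c v)))) => [|c _].
  rewrite -scaler_sumr (sum_delta _ (fun c => Q (coef (iota g) c v))) => /eqP.
  by rewrite -subr_eq0 -scalerBl scaler_eq0 subr_eq0 (negPf chi_h).
rewrite [x * _](_ : _ = chi c.1 *: (HDe c * x)); last first.
  by rewrite mulrA (HD_xg H_is_HD) -scalerAl -!mulrA -exprSr -exprS.
rewrite linearZ /= co_HDe_x scalerA.
have [<-|_] := eqVneq (h, m) c; first by [].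
by rewrite scaler0 mulr0.
Qed.

Lemma coef_iota_eq0 g h (l : 'I_n) v : (0 < l)%N -> coef (iota g) (h, l) v = 0.
Proof.
have [z1|/coef_iota_z_neq1] := eqVneq z 1%g; last exact.
have p1 : chi z = 1.
  have [chi0 chiM] := chi_char.
  by apply: (mulfI (chi0 1%g)); rewrite mulr1 z1 -chiM mulg1.
have /andP[q1 qN1] := q_neq p1.
(* Here q has order n and is neither 1 nor -1; n > 2 permits m = 1 in [coef_iota_chi]. *)
have n_gt2 : (2 < n)%N.
  rewrite ltn_neqAle n_gt1 andbT; apply: contraTneq qp_order => <-.
  rewrite p1 mulr1; apply/negP => /prim_expr_order/eqP.
  by rewrite sqrf_eq1 (negPf q1) (negPf qN1).
(* If T(g, h x) u were nonzero, m = 1 would give chi(h) = chi(g) q, while m = 0, applied to T(g, h)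
   T(g, h x) u = T(g, h x) u, would give chi(h) = chi(g). *)
apply: coef_iota_deg1 => {}h u; apply/eqP; apply: contraT => N0.
have := @coef_iota_chi g h o1 u n_gt2 N0.
rewrite (_ : chi h = chi g) => [/eqP|].
  rewrite -{1}[chi g]mulr1 (inj_eq (mulfI _)) ?(proj1 chi_char) //=.
  by rewrite eq_sym (negPf q1).
rewrite -[RHS]mulr1.
apply: (@coef_iota_chi g h o0 (coef (iota g) (h, o1) u) n_gt1).
by rewrite (coef_iota_deg0 g h o1 u); exact: N0.
Qed.

(** * Joint eigenspaces of the T(g, h), and the automorphism alpha *)

Definition gcoef g h v := coef (iota g) (h, o0) v.

Lemma s_iota g v : s (iota g *t v) = \sum_h gcoef g h v *t iota h.
Proof.
rewrite coef_sum.
pose F h (i : 'I_n) := coef (iota g) (h, i) v *t HDe (h, i).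
rewrite (eq_bigr (fun b : gT * 'I_n => F b.1 b.2)); last by case.
rewrite -(pair_bigA _ F) /F /=.
apply: eq_bigr => h _; rewrite (bigD1 o0) //= HDe0 big1 ?addr0 // => i i0.
by rewrite coef_iota_eq0 ?linear0l ?ord_pos.
Qed.

Lemma gcoef_z h v : h != z -> gcoef z h v = 0.
Proof. by move/(Q_z v)/Q_eq0. Qed.

Lemma s_z v : s (iota z *t v) = v *t iota z.
Proof.
have vz : gcoef z z v = v.
  rewrite -[RHS](coef_counit z) (bigD1 z) //= big1 ?addr0 // => h.
  exact: gcoef_z.
rewrite s_iota (bigD1 z) //= vz big1 ?addr0 // => h hz.
by rewrite gcoef_z // linear0l.
Qed.

Lemma coefx_comm_iota g c v : coef (iota g) c (Q v) = Q (coef (iota g) c v).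
Proof.
case: c => h l; have [->|l0] := eqVneq l o0; first exact: coef_iota_comm_x.
by rewrite !coef_iota_eq0 ?ord_pos ?coef0.
Qed.

Lemma gcoef_lin g h : linear (gcoef g h).
Proof. by move=> c u v; rewrite /gcoef coefP. Qed.

Lemma gcoef_idem g h h' v :
  gcoef g h (gcoef g h' v) = (h' == h)%:R *: gcoef g h v.
Proof. exact: coef_iota_idem. Qed.

Lemma gcoef_sum g v : \sum_h gcoef g h v = v.
Proof. exact: coef_counit. Qed.

Lemma gcoef_comm g g' h h' v :
  gcoef g h (gcoef g' h' v) = gcoef g' h' (gcoef g h v).
Proof. by have := coef_iota_comm g h (g', o0) (h', o0) v; rewrite HDe0. Qed.

Local Notation eigen := (joint_eigen gcoef).

Lemma eigen_s f v g : eigen f v -> s (iota g *t v) = v *t iota (f g).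
Proof.
move=> fv; rewrite s_iota (bigD1 (f g)) //= (fv g).
rewrite big1 ?addr0 // => h /negPf hf.
rewrite (joint_eigenE gcoef_idem g h fv) eq_sym hf.
by rewrite scale0r linear0l.
Qed.

Lemma tens_iota_inj (u : V) g h : u != 0 -> u *t iota g = u *t iota h -> g = h.
Proof.
move=> u0 /(congr1 (cor co (g, o0))); rewrite -!HDe0 !corE !coE eqxx scale1r.
have [[]//|_] := (g, o0) =P (h, o0); rewrite scale0r => u0'.
by rewrite u0' eqxx in u0.
Qed.

Local Notation AutG := (subg_of (Aut_chi_z_group chi z)).

(** Here s(g ⊗ u) = u ⊗ f(g) for all g. Multiplicativity and injectivity of f come from those of s,
    f(z) = z from [s_z], and invariance of chi from [coef_iota_chi] at m = 0. *)
Lemma eigen_aut f u : eigen f u -> u != 0 ->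
  exists zeta : AutG, sgval zeta =1 f.
Proof.
move=> fu u0.
have fM g h : f (g * h)%g = (f g * f h)%g.
  apply: (tens_iota_inj u0); rewrite -(eigen_s _ fu) !(HD_iotaM H_is_HD).
  exact: (space_mul (eigen_s h fu) (eigen_s g fu)).
have f_inj : injective f.
  move=> g h fgh; have : s (iota g *t u) = s (iota h *t u).
    by rewrite !(eigen_s _ fu) fgh.
  move/space_ext/(congr1 (col co (g, o0))).
  rewrite -!HDe0 !colE !coE eqxx scale1r.
  have [[]//|_] := (g, o0) =P (h, o0); rewrite scale0r => u0'.
  by rewrite u0' eqxx in u0.
have fA : perm f_inj \in Aut_chi_z_group chi z.
  rewrite Aut_chi_zE; apply/and3P; split.
  - rewrite inE; apply/andP; split; first by apply/subsetP => g _; rewrite inE.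
    by apply/morphicP => g h _ _; rewrite !permE fM.
  - apply/eqP; rewrite permE; apply: (tens_iota_inj u0).
    by rewrite -(eigen_s z fu) s_z.
  apply/forallP => g; rewrite permE; apply/eqP.
  rewrite -[RHS]mulr1; apply: (@coef_iota_chi g (f g) o0 u n_gt1).
  by rewrite -[coef _ _ _]/(gcoef g (f g) u) fu.
by exists (Subg fA) => g; rewrite /= permE.
Qed.

Definition eigenspace (zeta : AutG) : {pred V} :=
  fun v => `[< eigen (sgval zeta) v >].

Lemma eigenspaceP (zeta : AutG) v :
  reflect (eigen (sgval zeta) v) (v \in eigenspace zeta).
Proof. exact: asboolP. Qed.

Lemma eigenspace_gradation : gradation eigenspace.
Proof.
split=> [zeta|v].
  split=> [|c u v /eigenspaceP uE /eigenspaceP vE]; apply/eigenspaceP => g.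
    exact: coef0.
  by rewrite gcoef_lin uE vE.
pose ff (zeta : AutG) := [ffun g => sgval zeta g].
have ffE zeta w : eigen (ff zeta) w <-> w \in eigenspace zeta.
  by split=> [wE|/eigenspaceP wE]; first apply/eigenspaceP; move=> g;
    have := wE g; rewrite ffunE.
have ff_inj : injective ff.
  move=> a b /ffunP ab; apply/val_inj/permP => g.
  by have := ab g; rewrite !ffunE.
have [w0 [vw0 w0E]] := joint_decomposition gcoef_lin gcoef_idem
  gcoef_sum gcoef_comm v.
exists [ffun zeta => w0 (ff zeta)]; split=> [|w [wE vw]].
  split=> [zeta|]; first by rewrite ffunE; apply/ffE.
  under eq_bigr => zeta _ do rewrite ffunE.
  rewrite (partition_big ff xpredT) //= [LHS]vw0; apply: eq_bigr => f _.
  have [zeta /eqP <-|no_f] := pickP (fun zeta => ff zeta == f).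
    by rewrite (big_pred1 zeta) // => a; rewrite (inj_eq ff_inj).
  (* A component at a function outside the image of [ff] vanishes, since by [eigen_aut] a nonzero
     one would put that function in the image. *)
  rewrite big_pred0 //; apply/eqP; apply: contraT.
  move=> /(eigen_aut (w0E f))[zeta fE].
  have := no_f zeta; rewrite (_ : ff zeta = f) ?eqxx //.
  by apply/ffunP => g; rewrite ffunE.
(* Uniqueness: [joint_proj] recovers the components of both decompositions from [v]. *)
apply/ffunP => zeta; rewrite ffunE.
have pr (f : {ffun gT -> gT}) : joint_proj gcoef f v = w0 f.
  rewrite vw0 joint_proj_sum; last exact: gcoef_lin.
  under eq_bigr => f' _.
    rewrite (joint_proj_eigen gcoef_lin gcoef_idem f (w0E f')) eq_sym.
    over.
  exact: (sum_delta f w0).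
rewrite -pr vw joint_proj_sum; last exact: gcoef_lin.
rewrite -[RHS](sum_delta zeta w); apply: eq_bigr => a _.
have /ffE aE := wE a.
by rewrite (joint_proj_eigen gcoef_lin gcoef_idem _ aE) (inj_eq ff_inj) eq_sym.
Qed.

Lemma s_expx v i : s (x ^+ i *t v) = iter i Q v *t x ^+ i.
Proof.
elim: i v => [|i IHi] v; first exact: (left_space1 s_space).
by rewrite exprSr iterSr; apply: space_mul (s_x v) (IHi _).
Qed.

(** s(g x^i ⊗ v) is s(g ⊗ Q^i v) multiplied on the right by x^i. For i > 0 a factor Q can be pulled
    out, as it commutes with T(g, -); for i = 0 the coefficient T(g, x) v is zero. *)
Lemma coef_HDe_Q (b : gT * 'I_n) v :
  exists u, coef (HDe b) (1%g, o1) v = Q u.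
Proof.
case: b => g [i ni]; have := coef_mul_tensr (iota g) (1%g, o1) (s_expx v i).
rewrite [HDe _]/(iota g * x ^+ i) => ->; case: i {ni} => [|i].
  exists 0; rewrite coef0 big1 // => -[h l] _; have [->|l0] := eqVneq l o0.
    by rewrite mulr1 coE xpair_eqE andbF scale0r.
  by rewrite coef_iota_eq0 ?scaler0 ?ord_pos.
exists (\sum_d (co (1%g, o1) (HDe d * x ^+ i.+1) : k) *:
  coef (iota g) d (iter i Q v)).
by rewrite coef_sumr; apply: eq_bigr => d _; rewrite coefx_comm_iota coefZ.
Qed.

(** Apply s to the preimage of v ⊗ x: the coefficient at x is v, and by [coef_HDe_Q] it is a sum of
    values of Q. *)
Lemma Q_surj v : exists u, Q u = v.
Proof.
have [s' _ sK] := left_space_bij s_space; pose t := s' (v *t x).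
have [u uE] := choice (fun b => coef_HDe_Q b (col co b t)).
exists (\sum_b u b); rewrite coef_sumr.
have : cor co (1%g, o1) (s t) = v by rewrite sK corE -HDe1 coE eqxx scale1r.
rewrite (col_sum co_sum t) !linear_sum => <-.
by apply: eq_bigr => b _; rewrite -uE.
Qed.

Lemma left_space_has_form :
  exists (W : AutG -> {pred V}) (alpha : {linear V -> V}),
    graded_auto lambda n iota W alpha /\ has_form n iota x W alpha s.
Proof.
have [alpha alphaE] := linear_ex (fun c u v => coefP x (1%g, o1) c u v).
have itE i : iter i alpha =1 iter i Q by move=> v; apply: eq_iter.
(* Q commutes with T(g, h) and is injective, so it preserves and reflects joint eigenvectors. *)
have eigenQ zeta v : Q v \in eigenspace zeta = (v \in eigenspace zeta).
  apply/eigenspaceP/eigenspaceP => vE g; last first.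
    by rewrite [LHS]coefx_comm_iota -[in RHS](vE g).
  by apply: Q_inj; rewrite -coefx_comm_iota; apply: vE.
have eigen_iter zeta v i :
    v \in eigenspace zeta -> iter i Q v \in eigenspace zeta.
  by move=> vE; elim: i => //= i; rewrite eigenQ.
exists eigenspace, alpha; split; last first.
  move=> zeta v g i vW; rewrite itE; apply: space_mul (s_expx v i) _.
  exact/eigen_s/eigenspaceP/eigen_iter.
split.
- exact: eigenspace_gradation.
- have [beta betaE] := choice Q_surj.
  exists beta => v; last by rewrite alphaE betaE.
  by apply: Q_inj; rewrite betaE alphaE.
- move=> zeta; apply/classical_sets.seteqP; split=> v /=.
    by case=> u uW <-; rewrite alphaE eigenQ.
  have [u <-] := Q_surj v; rewrite eigenQ => uW.
  by exists u => //; rewrite alphaE.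
(* Transposing x^n in two ways gives Q^n v ⊗ x^n = s(x^n ⊗ v) = v ⊗ lambda (z^n - 1), and the
   nonzero x^n = lambda (z^n - 1) can be cancelled. *)
move=> xn0 v; rewrite itE; apply: (tensr_inj co_sum xn0).
rewrite -(HD_xn H_is_HD) -s_expx (HD_xn H_is_HD) linearZl_LR linearBl.
rewrite linearZ linearB /= (left_space1 s_space) iotaX.
have -> : s (iota z ^+ n *t v) = v *t iota z ^+ n.
  elim: n => [|m IHm]; first exact: (left_space1 s_space).
  by rewrite exprS; apply: space_mul IHm (s_z v).
by rewrite linearZr_LR linearBr.
Qed.

End Coefficients.

(** * Left spaces from a gradation and an automorphism *)

Section Construction.
Local Notation AutG := (subg_of (Aut_chi_z_group chi z)).
Variables (W : AutG -> {pred V}) (alpha : {linear V -> V}).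
Hypothesis alphaP : graded_auto lambda n iota W alpha.

Lemma Aut_chi_zP (zeta : AutG) :
  [/\ {morph sgval zeta : g h / (g * h)%g}, sgval zeta z = z
    & forall g, chi (sgval zeta g) = chi g].
Proof.
have := subgP zeta; rewrite Aut_chi_zE inE.
case/and3P=> /andP[_ /morphicP zM] /eqP zz /forallP zchi.
by split=> [g h||g] //; [rewrite zM ?inE | apply/eqP].
Qed.

Lemma Aut_chi_zX (zeta : AutG) m : (sgval zeta (z ^+ m) = z ^+ m)%g.
Proof.
have [zM zz _] := Aut_chi_zP zeta; elim: m => [|m IHm].
  by rewrite expg0; apply: (mulgI (sgval zeta 1%g)); rewrite -zM !mulg1.
by rewrite expgS zM zz IHm.
Qed.

Lemma iter_W zeta v i : v \in W zeta -> iter i alpha v \in W zeta.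
Proof.
have [_ _ aW _] := alphaP; move=> vW; elim: i => //= i IHi.
have /classical_sets.seteqP[+ _] := aW zeta; apply.
by exists (iter i alpha v).
Qed.

Lemma iter_linear i : linear (iter i alpha).
Proof.
by elim: i => [|i IHi] a u v //=; rewrite -linearP -IHi.
Qed.

Lemma iter_linear0 i : iter i alpha 0 = 0.
Proof. by elim: i => //= i ->; rewrite linear0. Qed.

Lemma graded_ext (X : lmodType k) (f g : {linear H ⊗ V -> X}) :
    (forall b zeta v, v \in W zeta -> f (HDe b *t v) = g (HDe b *t v)) ->
  f =1 g.
Proof.
have [/gradation_proj[pi [piW pi_sum _]] _ _ _] := alphaP.
move=> fg; apply: (tensor_basis_ext co_sum) => b v.
rewrite (pi_sum v) linear_sumr !linear_sum.
by apply: eq_bigr => zeta _; apply: fg.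
Qed.

Lemma graded_ext3 (X : lmodType k) (f g : {linear H ⊗ H ⊗ V -> X}) :
    (forall b c zeta v, v \in W zeta ->
      f (HDe b *t HDe c *t v) = g (HDe b *t HDe c *t v)) ->
  f =1 g.
Proof.
have [/gradation_proj[pi [piW pi_sum _]] _ _ _] := alphaP.
move=> fg; apply: (tensor3_basis_ext co_sum) => b c v.
rewrite (pi_sum v) linear_sumr !linear_sum.
by apply: eq_bigr => zeta _; apply: fg.
Qed.

Lemma has_form_ex :
  exists s : {linear H ⊗ V -> V ⊗ H}, has_form n iota x W alpha s.
Proof.
have [/gradation_proj[pi [piW pi_sum piE]] _ _ _] := alphaP.
pose f (t : H ⊗ V) := \sum_(b : gT * 'I_n) \sum_(zeta : AutG)
  iter b.2 alpha (pi zeta (col co b t)) *t HDe (sgval zeta b.1, b.2).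
have f_lin : linear f.
  move=> a t t'; rewrite scaler_sumr -big_split; apply: eq_bigr => b _ /=.
  rewrite scaler_sumr -big_split; apply: eq_bigr => zeta _ /=.
  by rewrite !linearP iter_linear linearPl.
have [s sE] := linear_ex f_lin; exists s => zeta v g i vW.
rewrite sE /f (bigD1 (g, i)) //= [X in _ + X]big1 ?addr0.
  rewrite (bigD1 zeta) //= big1 ?addr0 => [|zeta' zz'].
    by rewrite colE -/(HDe (g, i)) coE eqxx scale1r (piE _ _ _ vW) eqxx scale1r.
  rewrite colE -/(HDe (g, i)) coE eqxx scale1r (piE _ _ _ vW) (negPf zz').
  by rewrite scale0r iter_linear0 linear0l.
move=> b /negPf bgi; rewrite big1 // => zeta' _.
by rewrite colE -/(HDe (g, i)) coE bgi scale0r linear0 iter_linear0 linear0l.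
Qed.

Section Form.
Variable s : {linear H ⊗ V -> V ⊗ H}.
Hypothesis s_form : has_form n iota x W alpha s.

Lemma has_form_uniq (s' : {linear H ⊗ V -> V ⊗ H}) :
  has_form n iota x W alpha s' -> s' =1 s.
Proof.
move=> s'_form; apply: graded_ext => -[g i] zeta v vW.
by rewrite [LHS](s'_form _ _ _ _ vW) [RHS](s_form _ _ vW).
Qed.

(** The exponent is unrestricted because products lead to x^(i+j) with i + j >= n. For i >= n,
    reduce by x^n = lambda (z^n - 1): if x^n = 0 both sides vanish; otherwise alpha^n = id, and zeta
    fixes z. *)
Lemma has_form_expx zeta v g i : v \in W zeta ->
  s ((iota g * x ^+ i) *t v) =
  iter i alpha v *t (iota (sgval zeta g) * x ^+ i).
Proof.
move=> vW; have [zM _ _] := Aut_chi_zP zeta.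
elim/ltn_ind: i g => i IHi g; have [i_n|n_i] := ltnP i n.
  exact: (s_form g (Ordinal i_n) vW).
have xi u : iota u * x ^+ i = lambda *: (iota (u * z ^+ n)%g * x ^+ (i - n)
    - iota u * x ^+ (i - n)).
  rewrite -{1}(subnKC n_i) exprD (HD_xn H_is_HD) -scalerAl -scalerAr.
  by rewrite mulrBl mul1r mulrBr mulrA -(HD_iotaM H_is_HD).
have i'_i : (i - n < i)%N.
  by rewrite ltn_subrL (ltnW n_gt1) (leq_trans _ n_i) // ltnW.
have [xn0|xn0] := eqVneq (lambda *: (iota (z ^+ n)%g - 1)) 0.
  have xi0 : x ^+ i = 0.
    by rewrite -(subnKC n_i) exprD (HD_xn H_is_HD) xn0 mul0r.
  by rewrite xi0 !mulr0 linear0l linear0r linear0.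
have [_ _ _ /(_ xn0) alpha_n] := alphaP.
have -> : iter i alpha v = iter (i - n) alpha v.
  by rewrite -[in LHS](subnKC n_i) iterD alpha_n.
rewrite !xi linearZl_LR linearBl linearZ linearB /= !IHi //.
by rewrite linearZr_LR linearBr zM Aut_chi_zX.
Qed.

Lemma has_form_tens zeta v g h i j : v \in W zeta ->
  tapp12 s (tapp23 s ((iota g * x ^+ i) *t (iota h * x ^+ j) *t v)) =
  iter (i + j) alpha v *t (iota (sgval zeta g) * x ^+ i)
    *t (iota (sgval zeta h) * x ^+ j).
Proof.
move=> vW; rewrite tapp23E (has_form_expx _ _ vW) tassocVE tapp12E.
by rewrite (has_form_expx _ _ (iter_W j vW)) iterD.
Qed.

Lemma has_form_bij : bijective s.
Proof.
have [/gradation_proj[pi [piW pi_sum piE]] [beta alphaK betaK] aW _] := alphaP.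
have betaW zeta v : v \in W zeta -> beta v \in W zeta.
  have /classical_sets.seteqP[_ /(_ v) aWv] := aW zeta.
  by move=> /aWv[u uW <-]; rewrite alphaK.
have iter_betaW zeta v i : v \in W zeta -> iter i beta v \in W zeta.
  by move=> vW; elim: i => //= i /betaW.
have iterK i : cancel (iter i beta) (iter i alpha).
  by elim: i => // i IHi v; rewrite [iter _ beta _]iterSr /= IHi betaK.
have iter_inj i : injective (iter i alpha).
  by elim: i => // i IHi u v /= /(can_inj alphaK)/IHi.
(* The zeta-part of the image at (zeta(g), i) comes only from the zeta-part at (g, i), through the
   injective alpha^i; hence s is injective. *)
have s_coef zeta g (i : 'I_n) t :
    pi zeta (cor co (sgval zeta g, i) (s t)) =
    iter i alpha (pi zeta (col co (g, i) t)).
  have [a aE] := linear_ex (iter_linear i); rewrite -aE.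
  pose f1 : {linear H ⊗ V -> V} := pi zeta \o cor co (sgval zeta g, i) \o s.
  pose f2 : {linear H ⊗ V -> V} := a \o pi zeta \o col co (g, i).
  rewrite -[LHS]/(f1 t) -[RHS]/(f2 t); apply: graded_ext => -[h j] zeta' v vW.
  rewrite /f1 /f2 /= (has_form_expx _ _ vW) corE colE.
  rewrite -[_ * _]/(HDe (sgval zeta' h, j)) !coE !linearZ /=.
  rewrite (piE _ _ _ (iter_W j vW)) (piE _ _ _ vW) linearZ /= aE.
  have [->|] := eqVneq zeta zeta'; last first.
    by rewrite !scale0r iter_linear0 scaler0.
  rewrite !xpair_eqE (inj_eq perm_inj) !scale1r.
  by have [->|] := eqVneq i j; rewrite // andbF !scale0r.
have s_inj : injective s.
  move=> t t' tt'; rewrite (col_sum co_sum t) (col_sum co_sum t').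
  apply: eq_bigr => -[g i] _; congr (_ *t _).
  rewrite (pi_sum (col _ _ t)) (pi_sum (col _ _ t')); apply: eq_bigr => zeta _.
  by apply: (iter_inj i); rewrite -!s_coef tt'.
(* The inverse undoes zeta on the group and alpha on V. Only s r = id is computed; injectivity of s
   gives the other side. *)
pose r (t : V ⊗ H) : H ⊗ V := \sum_(b : gT * 'I_n) \sum_(zeta : AutG)
  HDe ((sgval zeta)^-1%g b.1, b.2) *t iter b.2 beta (pi zeta (cor co b t)).
have rK : cancel r s.
  move=> t; rewrite [RHS](cor_sum co_sum) linear_sum; apply: eq_bigr => b _.
  rewrite [in RHS](pi_sum (cor co b t)) linear_sumlz linear_sum.
  apply: eq_bigr => zeta _ /=.
  rewrite (has_form_expx _ _ (iter_betaW _ _ _ (piW _ _))) iterK.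
  by rewrite permKV.
by exists r => // t; apply: s_inj; rewrite rK.
Qed.

Lemma has_form_left_space : left_space s.
Proof.
split.
- exact: has_form_bij.
- have [/gradation_proj[pi [piW pi_sum _]] _ _ _] := alphaP.
  have e1 : 1 = iota 1%g * x ^+ 0 by rewrite (HD_iota1 H_is_HD) mul1r.
  move=> v; rewrite (pi_sum v) linear_sumr linear_sum linear_sumlz.
  apply: eq_bigr => zeta _; have := has_form_expx 1%g 0 (piW zeta v).
  by have := Aut_chi_zX zeta 0; rewrite !expg0 => ->; rewrite -e1.
(* Multiplication: chi o zeta = chi matches the scalars from x^i h = chi(h)^i h x^i. *)
- apply: graded_ext3 => -[g i] [h j] zeta v vW.
  have [zM _ zchi] := Aut_chi_zP zeta.
  rewrite /= tmapE /= tmulE /HDe /= HDe_mul linearZl_LR linearZ /=.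
  rewrite (has_form_expx _ _ vW) (has_form_tens _ _ _ _ vW) tassocE tmapE /=.
  rewrite tmulE.
  by rewrite HDe_mul linearZr_LR zM zchi.
- apply: graded_ext => -[g i] zeta v vW; rewrite /= (has_form_expx _ _ vW).
  rewrite !tmapE tscalerE tscalelE /HDe /= !counit_HDe.
  by case: i => -[|i] ni /=; rewrite // !scale0r.
(* Comultiplication: zeta(g z^j) = zeta(g) z^j matches the terms of [comul_HDe]. *)
- apply: graded_ext => -[g i] zeta v vW; rewrite /= (has_form_expx _ _ vW).
  have [zM _ _] := Aut_chi_zP zeta.
  rewrite !tmapE /HDe /= !comul_HDe // linear_sumlz linear_sumr !linear_sum /=.
  apply: eq_bigr => j _; rewrite linearZr_LR linearZl_LR !linearZ /=.
  by rewrite (has_form_tens _ _ _ _ vW) tassocVE zM Aut_chi_zX subnKC // -ltnS.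
(* Braid: s keeps the exponents of x, so both sides carry the same power of q. *)
apply: graded_ext3 => -[g i] [h j] zeta v vW.
rewrite /= tapp12E (HD_braid H_is_HD) linearZl_LR !linearZ /=.
rewrite /HDe /= !(has_form_tens _ _ _ _ vW) tapp23E.
by rewrite (HD_braid H_is_HD) linearZr_LR linearZ /= tassocVE addnC.
Qed.

End Form.
End Construction.

End HDStructure.

Theorem proposition3p5 (k : fieldType) (gT : finGroupType) (chi : gT -> k)
    (z : gT) (lambda q : k) (n : nat)
    (chi_char : mult_char chi)
    (z_central : z \in 'Z([set: gT])%g)
    (q_neq0 : q != 0)
    (n_gt1 : (1 < n)%N)
    (qp_order : n.-primitive_root (q * chi z))
    (H : braidedHopf k) (iota : gT -> H) (x : H)
    (H_is_HD : is_HD chi z lambda q n iota x)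
    (chi_n : lambda *: (iota (z ^+ n)%g - 1) != 0 -> forall g, chi g ^+ n = 1)
    (pq : (chi z, q) != (1, -1))
    (V : lmodType k) :
  (forall (W : subg_of (Aut_chi_z_group chi z) -> {pred V})
          (alpha : {linear V -> V}),
      graded_auto lambda n iota W alpha ->
      exists s : {linear H ⊗ V -> V ⊗ H},
        [/\ has_form n iota x W alpha s,
            forall s' : {linear H ⊗ V -> V ⊗ H},
              has_form n iota x W alpha s' -> s' =1 s
          & left_space s])
  /\
  (forall s : {linear H ⊗ V -> V ⊗ H}, left_space s ->
      exists (W : subg_of (Aut_chi_z_group chi z) -> {pred V})
             (alpha : {linear V -> V}),
        graded_auto lambda n iota W alpha /\ has_form n iota x W alpha s).
Proof.
have [co [coE co_sum]] := HDe_coords H_is_HD.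
split=> [W alpha alphaP|s s_space]; last first.
  exact: (left_space_has_form chi_char n_gt1 qp_order H_is_HD coE co_sum
    s_space pq).
have [s s_form] := has_form_ex coE alphaP.
exists s; split=> // [s' s'_form|].
  exact: (has_form_uniq co_sum alphaP s_form s'_form).
exact: (has_form_left_space n_gt1 H_is_HD coE co_sum alphaP s_form).
Qed.
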